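(* Let $U\subseteq\widetilde{\mathbb C}$ be sharply open, $z_0\in U$ and $f\in\mathcal{GH}(U)$. Assume $f(z_0)=0$ and that there exists $n\in\mathbb N_{>0}$ with $f^{(n)}(z_0)\neq0$. Then there exist $L\subseteq_0 I$ and $r\in\widetilde{\mathbb R}_{>0}$ such that for every $z\in B_r(z_0)$ with $|z-z_0|>0$, the restriction $f(z)|_L$ is invertible.
   Context: Fix $I=(0,1]$ and a gauge $\rho=(\rho_\varepsilon)_{\varepsilon\in I}$ with $\rho_\varepsilon\in I$ and $\rho_\varepsilon\to0$ as $\varepsilon\to0$. ''$\forall^0\varepsilon$'' means ''for all sufficiently small $\varepsilon\in I$''. A net $(x_\varepsilon)\in\mathbb C^I$ is $\rho$-moderate ($(x_\varepsilon)\in\mathbb C_\rho$) if $\exists N\in\mathbb N\,\forall^0\varepsilon:|x_\varepsilon|\le\rho_\varepsilon^{-N}$, and $\rho$-negligible if $\forall q\in\mathbb N\,\forall^0\varepsilon:|x_\varepsilon|\le\rho_\varepsilon^q$. $\widetilde{\mathbb C}:=\mathbb C_\rho/\{\text{negligible nets}\}$ with classes $[x_\varepsilon]$; $\widetilde{\mathbb R}\subseteq\widetilde{\mathbb C}$ consists of classes of real moderate nets; $|[z_\varepsilon]|:=[|z_\varepsilon|]$. On $\widetilde{\mathbb R}$: $[x_\varepsilon]\le[y_\varepsilon]$ iff $x_\varepsilon\le y_\varepsilon+z_\varepsilon$ $\forall^0\varepsilon$ for some negligible $(z_\varepsilon)$; $x<y$ iff $\exists m\,\forall^0\varepsilon:y_\varepsilon-x_\varepsilon>\rho_\varepsilon^m$;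 $\widetilde{\mathbb R}_{>0}:=\{x:x>0\}$. The sharp topology on $\widetilde{\mathbb C}$ is generated by $B_r(c):=\{z:|z-c|<r\}$, $r\in\widetilde{\mathbb R}_{>0}$. $L\subseteq_0 I$ means $L\subseteq I$ and $0$ is an accumulation point of $L$; for $x=[x_\varepsilon]\in\widetilde{\mathbb C}$, ''$x|_L$ is invertible'' means $\exists m\in\mathbb N$ with $|x_\varepsilon|>\rho_\varepsilon^m$ for all sufficiently small $\varepsilon\in L$. Generalized holomorphic functions: for $U\subseteq\widetilde{\mathbb C}$ sharply open, $f\in\mathcal{GH}(U)$ means $f:U\to\widetilde{\mathbb C}$ and there exist open sets $\Omega_\varepsilon\subseteq\mathbb C$ and holomorphic $f_\varepsilon:\Omega_\varepsilon\to\mathbb C$ such that for every $z\in U$ and every representative $z=[z_\varepsilon]$: $z_\varepsilon\in\Omega_\varepsilon$ $\forall^0\varepsilon$, $f(z)=[f_\varepsilon(z_\varepsilon)]$, and $(f_\varepsilon^{(k)}(z_\varepsilon))\in\mathbb C_\rho$ for all $k\in\mathbb N$; $f^{(k)}(z):=[f^{(k)}_\varepsilon(z_\varepsilon)]$. *)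

(* Defs.v *)
From Stdlib Require Import Reals.
From Coquelicot Require Import Coquelicot.
Open Scope R_scope.

(** Nets indexed by eps in I = (0,1]; values outside I are irrelevant. *)
Definition cnet := R -> C.
Definition rnet := R -> R.

Definition ev (P : R -> Prop) : Prop :=
  exists e0, 0 < e0 <= 1 /\ forall e, 0 < e <= e0 -> P e.

Definition gauge (rho : rnet) : Prop :=
  (forall e, 0 < e <= 1 -> 0 < rho e <= 1) /\
  (forall d, 0 < d -> ev (fun e => rho e < d)).

Definition moderate (rho : rnet) (x : cnet) : Prop :=
  exists N : nat, ev (fun e => Cmod (x e) <= / (rho e ^ N)).

Definition negligible (rho : rnet) (x : cnet) : Prop :=
  forall q : nat, ev (fun e => Cmod (x e) <= rho e ^ q).

Definition rmoderate (rho : rnet) (x : rnet) : Prop :=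
  exists N : nat, ev (fun e => Rabs (x e) <= / (rho e ^ N)).

Definition glt (rho : rnet) (x y : rnet) : Prop :=
  exists m : nat, ev (fun e => y e - x e > rho e ^ m).

Definition gpos (rho : rnet) (r : rnet) : Prop := rmoderate rho r /\ glt rho (fun _ => 0) r.

Definition cabs (z : cnet) : rnet := fun e => Cmod (z e).
Definition csub (z w : cnet) : cnet := fun e => Cminus (z e) (w e).

Definition ball_sharp (rho : rnet) (c : cnet) (r : rnet) (z : cnet) : Prop :=
  moderate rho z /\ glt rho (cabs (csub z c)) r.

(** A subset of C~, given as a predicate on representatives that is
    compatible with the quotient (contains only moderate nets, closed under
    adding negligible nets). *)
Definition gsubset (rho : rnet) (U : cnet -> Prop) : Prop :=
  (forall x, U x -> moderate rho x) /\
  (forall x y, U x -> negligible rho (csub y x) -> U y).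

Definition sharply_open (rho : rnet) (U : cnet -> Prop) : Prop :=
  gsubset rho U /\
  forall c, U c -> exists r, gpos rho r /\ forall z, ball_sharp rho c r z -> U z.

Definition Cderiv_n (k : nat) (g : C -> C) : C -> C := Nat.iter k C_derive g.

Definition holomorphic_on (O : C -> Prop) (g : C -> C) : Prop :=
  @open C_UniformSpace O /\
  forall w, O w -> @ex_derive C_AbsRing C_NormedModule g w.

(** f in GH(U), given by the defining nets (Omega_eps, f_eps);
    then f(z) = [f_eps(z_eps)] and f^(k)(z) = [f_eps^(k)(z_eps)]. *)
Definition GH (rho : rnet) (U : cnet -> Prop)
    (Om : R -> C -> Prop) (fe : R -> C -> C) : Prop :=
  (forall e, 0 < e <= 1 -> holomorphic_on (Om e) (fe e)) /\
  forall z, U z ->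
    ev (fun e => Om e (z e)) /\
    forall k : nat, moderate rho (fun e => Cderiv_n k (fe e) (z e)).

Definition gapp (fe : R -> C -> C) (z : cnet) : cnet := fun e => fe e (z e).
Definition gderiv (k : nat) (fe : R -> C -> C) (z : cnet) : cnet :=
  fun e => Cderiv_n k (fe e) (z e).

Definition subset0 (L : R -> Prop) : Prop :=
  (forall e, L e -> 0 < e <= 1) /\
  (forall d, 0 < d -> exists e, L e /\ e < d).

Definition invertible_on (rho : rnet) (L : R -> Prop) (x : cnet) : Prop :=
  exists m : nat, exists e0, 0 < e0 /\
    forall e, L e -> e <= e0 -> Cmod (x e) > rho e ^ m.

(* Main.v *)
(** Let [n] be the least index with [f^(n)(z0)] not negligible; then
    [|f^(n)(z0)| > rho^q] along some set [L] accumulating at [0].  A diagonal argument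
    bounds [f^(n+1)] by [rho^-N] on the balls [B(z0, rho^N)], uniformly for small eps,
    so by Taylor's formula [f(z)] is [f^(n)(z0) h^n / n!], with [h = z - z0], up to
    negligible terms and an error [rho^-N |h|^(n+1)], and on [L] the first term
    dominates as soon as [|h| < rho^(N+q+1)].

    Taylor's formula needs the derivative of a holomorphic function to be
    holomorphic.  By Goursat's lemma [f] has a local primitive [F].  If [F' = f] is
    continuous then [F] has the mean value property on circles; differentiating it
    and integrating by parts gives
    [2 pi r f(z) = int_0^{2 pi} F(z + r e^{ix}) e^{-ix} dx], and the right-hand side is
    C^1 in [z] with derivative [int f(z + r e^{ix}) e^{-ix} dx].  So [f] is C^1, and the
    same argument for the pair [f, f'] shows that [f'] is differentiable. *)

Require Import Defs.
From Stdlib Require Import Reals Factorial Lra Lia ClassicalEpsilon Classical.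
From Coquelicot Require Import Coquelicot.
Open Scope R_scope.

(** * Derivatives and integrals of complex-valued functions *)

(** The order of choices shapes the final argument: [L] and the radius must serve every [z], so they
    may depend only on [q], on [N] and on a ball inside [U]. The exponent [m] with
    [|z - z0| > rho^m] appears only afterwards. The lower derivatives at [z0] can still be beaten,
    because negligibility bounds them by [rho^Q] for any [Q]: the leading term is at least
    [rho^(q + n m) / n!], so [Q = q + n m + 1] suffices, and this [Q] is also the exponent
    witnessing invertibility.

    [GH] controls derivatives only along nets, one point per index, whereas a Taylor remainder at a
    fixed index needs a bound on a whole disc contained in [Om]. The diagonal argument supplies the
    bound and the inclusion together.

    At a fixed index only pointwise complex differentiability is given, while integrating a
    derivative along a path needs its continuity. Passing to a primitive [F] avoids this: its
    derivative [f] is continuous because [f] is differentiable. The circle formulas applied to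
    [F, f] then give a continuous [f'], and applied to [f, f'] they give a derivative of [f']. *)

Notation is_C_derive := (@is_derive C_AbsRing C_NormedModule).
Notation is_RC_derive := (@is_derive R_AbsRing C_R_NormedModule).
Notation C_continuous := (@continuous C_UniformSpace C_UniformSpace).
Notation RC_continuous := (@continuous R_UniformSpace C_UniformSpace).
Notation is_CRInt := (@is_RInt C_R_NormedModule).

(* [ring] does not see through the carriers of the normed modules over [C]. *)
Ltac Cring := match goal with |- @eq _ ?x ?y => change (@eq C x y); ring end.

Lemma Cmod_le_abs (z : C) : Cmod z <= Rabs (fst z) + Rabs (snd z).
Proof.
  destruct z as [x y]; unfold Cmod; simpl.
  assert (Hx := Rabs_pos x); assert (Hy := Rabs_pos y).
  rewrite <- (sqrt_Rsqr (Rabs x + Rabs y)) by lra.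
  apply sqrt_le_1_alt; unfold Rsqr.
  assert (H1 := Rsqr_abs x); assert (H2 := Rsqr_abs y); unfold Rsqr in *. nra.
Qed.

Lemma Cmod_fst_le (z : C) : Rabs (fst z) <= Cmod z.
Proof.
  eapply Rle_trans; [ | apply Rmax_Cmod ]. apply Rmax_l.
Qed.

Lemma Cmod_snd_le (z : C) : Rabs (snd z) <= Cmod z.
Proof.
  eapply Rle_trans; [ | apply Rmax_Cmod ]. apply Rmax_r.
Qed.

Lemma norm_CR (z : C) : @norm R_AbsRing C_R_NormedModule z = Cmod z.
Proof.
  destruct z as [x y]; unfold norm, Cmod; simpl; unfold prod_norm, norm; simpl.
  f_equal. unfold abs; simpl.
  assert (H1 := Rsqr_abs x); assert (H2 := Rsqr_abs y); unfold Rsqr in *. nra.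
Qed.

(** The uniform structure of [C] is the product one, whose balls are squares; a square of half the
    radius fits into the disc. *)
Lemma locally_C_Cmod (z : C) (P : C -> Prop) :
  @locally C_UniformSpace z P <->
  exists d, 0 < d /\ forall w, Cmod (w - z) < d -> P w.
Proof.
  split.
  - intros [d Hd]. exists d. split; [ apply cond_pos | ].
    intros w Hw. apply Hd. now apply C_NormedModule_mixin_compat1.
  - intros [d [Hd H]]. assert (Hd2 : 0 < d / 2) by lra.
    exists (mkposreal _ Hd2). intros w [Hw1 Hw2]. apply H.
    eapply Rle_lt_trans; [ apply Cmod_le_abs | ].
    change (Rabs (fst w - fst z) < d / 2) in Hw1.
    change (Rabs (snd w - snd z) < d / 2) in Hw2.
    simpl. unfold Rminus in *. lra.
Qed.

Lemma continuous_Cmod (T : UniformSpace) (g : T -> C) (x : T) :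
  @continuous T C_UniformSpace g x <->
  forall eps, 0 < eps -> locally x (fun y => Cmod (g y - g x) < eps).
Proof.
  split.
  - intros H eps Heps. apply (H (fun w => Cmod (w - g x) < eps)). apply locally_C_Cmod. exists eps. auto.
  - intros H P HP. apply locally_C_Cmod in HP. destruct HP as [d [Hd HP]].
    specialize (H d Hd). unfold filtermap.
    apply (filter_imp _ _ (fun y => HP (g y)) H).
Qed.

Lemma C_continuous_eps (f : C -> C) (z : C) :
  C_continuous f z <->
  forall eps, 0 < eps -> exists d, 0 < d /\ forall w, Cmod (w - z) < d -> Cmod (f w - f z) < eps.
Proof.
  rewrite continuous_Cmod. split; intros H eps Heps; specialize (H eps Heps);
  now apply locally_C_Cmod.
Qed.

(** [is_derive] takes neighbourhoods in the ring norm of [C]; [locally_C] passes between them and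
    the product ones. *)
Lemma is_C_derive_eps (f : C -> C) (z l : C) :
  is_C_derive f z l <->
  forall eps, 0 < eps -> exists d, 0 < d /\
    forall h, Cmod h < d -> Cmod (f (z + h) - f z - l * h)%C <= eps * Cmod h.
Proof.
  split.
  - intros [_ H] eps Heps.
    specialize (H z (fun P HP => HP) (mkposreal _ Heps)).
    apply locally_C, locally_C_Cmod in H. destruct H as [d [Hd H]].
    exists d. split; [ exact Hd | ]. intros h Hh.
    specialize (H (z + h)%C). replace (z + h - z)%C with h in H by ring.
    specialize (H Hh).
    change (Cmod (f (z + h)%C - f z - (z + h - z) * l)%C <= eps * Cmod (z + h - z)%C) in H.
    replace (z + h - z)%C with h in H by ring.
    now rewrite (Cmult_comm l h).
  - intros H. split; [ apply is_linear_scal_l | ].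
    intros z' Hz' eps.
    (* The differential is required at every limit point of the neighbourhood filter of [z]; by
       separation [z] is the only one. *)
    assert (Hzz : z = z').
    { apply (@is_filter_lim_locally_unique C_AbsRing (AbsRing_NormedModule C_AbsRing)). exact Hz'. }
    subst z'. destruct (H eps (cond_pos eps)) as [d [Hd Hd']].
    apply locally_C, locally_C_Cmod. exists d. split; [ exact Hd | ].
    intros w Hw. specialize (Hd' (w - z)%C Hw).
    change (Cmod (f w - f z - (w - z) * l)%C <= eps * Cmod (w - z)%C).
    replace (z + (w - z))%C with w in Hd' by ring.
    now rewrite (Cmult_comm (w - z) l).
Qed.

Lemma is_RC_derive_eps (g : R -> C) (t : R) (l : C) :
  is_RC_derive g t l <->
  forall eps, 0 < eps -> exists d, 0 < d /\
    forall s, Rabs s < d -> Cmod (g (t + s)%R - g t - RtoC s * l)%C <= eps * Rabs s.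
Proof.
  split.
  - intros [_ H] eps Heps.
    specialize (H t (fun P HP => HP) (mkposreal _ Heps)).
    destruct H as [d H].
    exists d. split; [ apply cond_pos | ]. intros s Hs.
    specialize (H (t + s)).
    assert (Hb : ball t d (t + s)).
    { change (Rabs (t + s - t) < d). now replace (t + s - t) with s by ring. }
    specialize (H Hb). rewrite norm_CR in H.
    change (Cmod (g (t + s)%R - g t - scal (t + s - t)%R l)%C <= eps * Rabs (t + s - t)) in H.
    replace (t + s - t) with s in H by ring.
    now rewrite scal_R_Cmult in H.
  - intros H. split; [ apply is_linear_scal_l | ].
    intros t' Ht' eps.
    assert (Htt : t = t').
    { apply (@is_filter_lim_locally_unique R_AbsRing R_NormedModule). exact Ht'. }
    subst t'. destruct (H eps (cond_pos eps)) as [d [Hd Hd']].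
    exists (mkposreal _ Hd). intros s Hs.
    specialize (Hd' (s - t) Hs). rewrite norm_CR.
    change (Cmod (g s - g t - scal (s - t)%R l)%C <= eps * Rabs (s - t)).
    rewrite scal_R_Cmult.
    now rewrite Rplus_minus in Hd'.
Qed.

Lemma is_C_derive_continuous (f : C -> C) (z l : C) :
  is_C_derive f z l -> C_continuous f z.
Proof.
  intros H. apply C_continuous_eps. intros eps Heps.
  rewrite is_C_derive_eps in H. destruct (H 1 Rlt_0_1) as [d [Hd Hd']].
  assert (Hl := Cmod_ge_0 l).
  assert (Hp : 0 < eps / (2 + Cmod l)) by (apply Rdiv_lt_0_compat; lra).
  exists (Rmin d (eps / (2 + Cmod l))). split; [ now apply Rmin_glb_lt | ].
  intros w Hw.
  assert (H1 := Rlt_le_trans _ _ _ Hw (Rmin_l _ _)).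
  assert (H2 := Rlt_le_trans _ _ _ Hw (Rmin_r _ _)).
  specialize (Hd' _ H1). replace (z + (w - z))%C with w in Hd' by ring.
  replace (f w - f z)%C with ((f w - f z - l * (w - z)) + l * (w - z))%C by ring.
  eapply Rle_lt_trans; [ apply Cmod_triangle | ]. rewrite Cmod_mult.
  apply (Rmult_lt_compat_r (2 + Cmod l)) in H2; [ | lra ].
  unfold Rdiv in H2. rewrite Rmult_assoc, Rinv_l in H2 by lra.
  assert (Hc := Cmod_ge_0 (w - z)). nra.
Qed.

(** The outer derivative is over [C] and the inner one over [R], so the chain rule is derived from
    the epsilon forms: the remainder is that of [f] at the increment [h] of [g], plus [l] times the
    remainder of [g]. *)
Lemma is_RC_derive_comp (f : C -> C) (g : R -> C) (t : R) (l m : C) :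
  is_C_derive f (g t) l -> is_RC_derive g t m ->
  is_RC_derive (fun s => f (g s)) t (l * m)%C.
Proof.
  rewrite is_C_derive_eps, !is_RC_derive_eps. intros Hf Hg eps Heps.
  assert (Hl := Cmod_ge_0 l). assert (Hm := Cmod_ge_0 m).
  (* The two remainders add up to at most [eta * (Cmod m + eta) + Cmod l * eta] times [Rabs s],
     hence to [eta * k] times it, as [eta <= 1]. *)
  set (k := Cmod m + 1 + Cmod l).
  assert (Hk : 0 < k) by (unfold k; lra).
  set (eta := Rmin 1 (eps / k)).
  assert (Heta : 0 < eta).
  { apply Rmin_glb_lt; [ lra | now apply Rdiv_lt_0_compat ]. }
  assert (Heta1 : eta <= 1) by apply Rmin_l.
  assert (Hetak : eta * k <= eps).
  { apply Rle_trans with (eps / k * k); [ | right; now field; lra ].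
    apply Rmult_le_compat_r; [ lra | apply Rmin_r ]. }
  destruct (Hf eta Heta) as [d1 [Hd1 H1]].
  destruct (Hg eta Heta) as [d2 [Hd2 H2]].
  assert (Hp : 0 < d1 / (Cmod m + 2)) by (apply Rdiv_lt_0_compat; lra).
  exists (Rmin d2 (d1 / (Cmod m + 2))). split; [ now apply Rmin_glb_lt | ].
  intros s Hs.
  assert (Hs2 := Rlt_le_trans _ _ _ Hs (Rmin_l _ _)).
  assert (Hs1 := Rlt_le_trans _ _ _ Hs (Rmin_r _ _)).
  specialize (H2 s Hs2).
  set (h := (g (t + s)%R - g t)%C) in *.
  assert (Habs := Rabs_pos s).
  assert (Hh : Cmod h <= (Cmod m + eta) * Rabs s).
  { replace h with ((h - RtoC s * m) + RtoC s * m)%C by ring.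
    eapply Rle_trans; [ apply Cmod_triangle | ]. rewrite Cmod_mult, Cmod_R. lra. }
  assert (Hhd : Cmod h < d1).
  { apply (Rmult_lt_compat_r (Cmod m + 2)) in Hs1; [ | lra ].
    unfold Rdiv in Hs1. rewrite Rmult_assoc, Rinv_l in Hs1 by lra. nra. }
  specialize (H1 h Hhd).
  replace (g t + h)%C with (g (t + s)%R) in H1 by (unfold h; ring).
  replace (f (g (t + s)%R) - f (g t) - RtoC s * (l * m))%C
    with ((f (g (t + s)%R) - f (g t) - l * h) + l * (h - RtoC s * m))%C by ring.
  eapply Rle_trans; [ apply Cmod_triangle | ]. rewrite Cmod_mult.
  apply Rle_trans with (eta * ((Cmod m + eta) * Rabs s) + Cmod l * (eta * Rabs s)).
  - apply Rplus_le_compat; [ eapply Rle_trans; [ exact H1 | ] | ];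
    apply Rmult_le_compat_l; lra.
  - apply Rle_trans with (eta * k * Rabs s).
    + unfold k.
      assert (0 <= eta * Rabs s) by (apply Rmult_le_pos; lra). nra.
    + now apply Rmult_le_compat_r.
Qed.

Lemma is_RC_derive_pair (g : R -> C) (t : R) (a b : R) :
  is_derive (fun s => fst (g s)) t a -> is_derive (fun s => snd (g s)) t b ->
  is_RC_derive g t (a, b).
Proof.
  intros Ha Hb. apply is_RC_derive_eps. intros eps Heps.
  assert (He : 0 < eps / 2) by lra.
  destruct Ha as [_ Ha], Hb as [_ Hb].
  specialize (Ha t (fun P HP => HP) (mkposreal _ He)).
  specialize (Hb t (fun P HP => HP) (mkposreal _ He)).
  destruct (filter_and _ _ Ha Hb) as [d Hd].
  exists d. split; [ apply cond_pos | ]. intros s Hs.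
  destruct (Hd (t + s)) as [H1 H2].
  { change (Rabs (t + s - t) < d). now replace (t + s - t) with s by ring. }
  change (Rabs (fst (g (t + s)) - fst (g t) - (t + s - t) * a) <= eps / 2 * Rabs (t + s - t)) in H1.
  change (Rabs (snd (g (t + s)) - snd (g t) - (t + s - t) * b) <= eps / 2 * Rabs (t + s - t)) in H2.
  replace (t + s - t) with s in H1, H2 by ring.
  eapply Rle_trans; [ apply Cmod_le_abs | ]. simpl.
  replace (fst (g (t + s)) + - fst (g t) + - (s * a - 0 * b)) with
    (fst (g (t + s)) - fst (g t) - s * a) by ring.
  replace (snd (g (t + s)) + - snd (g t) + - (s * b + 0 * a)) with
    (snd (g (t + s)) - snd (g t) - s * b) by ring.
  lra.
Qed.

Lemma RC_continuous_pair (g : R -> C) (t : R) :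
  continuous (fun s => fst (g s)) t -> continuous (fun s => snd (g s)) t ->
  RC_continuous g t.
Proof.
  intros Ha Hb. apply continuous_Cmod. intros eps Heps.
  assert (He : 0 < eps / 2) by lra.
  assert (Ha' := proj1 (filterlim_locally _ _) Ha (mkposreal _ He)).
  assert (Hb' := proj1 (filterlim_locally _ _) Hb (mkposreal _ He)).
  generalize (filter_and _ _ Ha' Hb'). apply filter_imp. intros s [H1 H2].
  change (Rabs (fst (g s) - fst (g t)) < eps / 2) in H1.
  change (Rabs (snd (g s) - snd (g t)) < eps / 2) in H2.
  eapply Rle_lt_trans; [ apply Cmod_le_abs | ]. simpl. unfold Rminus in *. lra.
Qed.

Lemma RC_continuous_fst (g : R -> C) (t : R) :
  RC_continuous g t -> continuous (fun s => fst (g s)) t.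
Proof.
  intros H. apply (continuous_comp g fst); [ exact H | ].
  destruct (g t); apply continuous_fst.
Qed.

Lemma RC_continuous_snd (g : R -> C) (t : R) :
  RC_continuous g t -> continuous (fun s => snd (g s)) t.
Proof.
  intros H. apply (continuous_comp g snd); [ exact H | ].
  destruct (g t); apply continuous_snd.
Qed.

Lemma RC_continuous_mult (g k : R -> C) (t : R) :
  RC_continuous g t -> RC_continuous k t -> RC_continuous (fun s => (g s * k s)%C) t.
Proof.
  intros Hg Hk.
  assert (G1 := RC_continuous_fst _ _ Hg). assert (G2 := RC_continuous_snd _ _ Hg).
  assert (K1 := RC_continuous_fst _ _ Hk). assert (K2 := RC_continuous_snd _ _ Hk).
  apply RC_continuous_pair; simpl.
  - apply (continuous_minus (V := R_NormedModule)); now apply (continuous_mult (K := R_AbsRing)).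
  - apply (continuous_plus (V := R_NormedModule)); now apply (continuous_mult (K := R_AbsRing)).
Qed.

Lemma is_RC_derive_continuous (g : R -> C) (t : R) (l : C) :
  is_RC_derive g t l -> RC_continuous g t.
Proof.
  intros H. apply (@ex_derive_continuous R_AbsRing C_R_NormedModule). now exists l.
Qed.

Lemma is_RC_derive_fst (g : R -> C) (t : R) (l : C) :
  is_RC_derive g t l -> is_derive (fun s => fst (g s)) t (fst l).
Proof.
  intros H. rewrite is_RC_derive_eps in H. split; [ apply is_linear_scal_l | ].
  intros t' Ht' eps.
  assert (Htt : t = t').
  { apply (@is_filter_lim_locally_unique R_AbsRing R_NormedModule). exact Ht'. }
  subst t'. destruct (H eps (cond_pos eps)) as [d [Hd Hd']].
  exists (mkposreal _ Hd). intros s Hs. specialize (Hd' (s - t) Hs).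
  rewrite Rplus_minus in Hd'.
  change (Rabs (fst (g s) - fst (g t) - (s - t) * fst l) <= eps * Rabs (s - t)).
  eapply Rle_trans; [ | exact Hd' ].
  eapply Rle_trans; [ | apply Cmod_fst_le ]. right. f_equal. simpl. ring.
Qed.

Lemma is_RC_derive_snd (g : R -> C) (t : R) (l : C) :
  is_RC_derive g t l -> is_derive (fun s => snd (g s)) t (snd l).
Proof.
  intros H. rewrite is_RC_derive_eps in H. split; [ apply is_linear_scal_l | ].
  intros t' Ht' eps.
  assert (Htt : t = t').
  { apply (@is_filter_lim_locally_unique R_AbsRing R_NormedModule). exact Ht'. }
  subst t'. destruct (H eps (cond_pos eps)) as [d [Hd Hd']].
  exists (mkposreal _ Hd). intros s Hs. specialize (Hd' (s - t) Hs).
  rewrite Rplus_minus in Hd'.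
  change (Rabs (snd (g s) - snd (g t) - (s - t) * snd l) <= eps * Rabs (s - t)).
  eapply Rle_trans; [ | exact Hd' ].
  eapply Rle_trans; [ | apply Cmod_snd_le ]. right. f_equal. simpl. ring.
Qed.

Lemma is_RC_derive_mult (g k : R -> C) (t : R) (l m : C) :
  is_RC_derive g t l -> is_RC_derive k t m ->
  is_RC_derive (fun s => (g s * k s)%C) t (l * k t + g t * m)%C.
Proof.
  intros Hg Hk.
  assert (G1 := is_RC_derive_fst _ _ _ Hg). assert (G2 := is_RC_derive_snd _ _ _ Hg).
  assert (K1 := is_RC_derive_fst _ _ _ Hk). assert (K2 := is_RC_derive_snd _ _ _ Hk).
  rewrite (surjective_pairing (l * k t + g t * m)%C).
  assert (Hc : forall x y : R_AbsRing, mult x y = mult y x) by (intros x y; apply Rmult_comm).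
  apply is_RC_derive_pair; simpl.
  - assert (H := is_derive_minus _ _ _ _ _ (is_derive_mult _ _ _ _ _ G1 K1 Hc)
      (is_derive_mult _ _ _ _ _ G2 K2 Hc)).
    revert H. unfold minus, plus, opp, mult; simpl. intros H.
    evar_last; [ exact H | simpl; ring ].
  - assert (H := is_derive_plus _ _ _ _ _ (is_derive_mult _ _ _ _ _ G1 K2 Hc)
      (is_derive_mult _ _ _ _ _ G2 K1 Hc)).
    revert H. unfold minus, plus, opp, mult; simpl. intros H.
    evar_last; [ exact H | simpl; ring ].
Qed.

(** * Integrals of complex-valued functions of a real variable *)

Lemma is_CRInt_Cmult (c : C) (g : R -> C) (a b : R) (l : C) :
  is_CRInt g a b l -> is_CRInt (fun t => (c * g t)%C) a b (c * l)%C.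
Proof.
  intros H.
  assert (H1 := is_RInt_fct_extend_fst (U := R_NormedModule) (V := R_NormedModule) _ _ _ _ H).
  assert (H2 := is_RInt_fct_extend_snd (U := R_NormedModule) (V := R_NormedModule) _ _ _ _ H).
  apply (is_RInt_fct_extend_pair (U := R_NormedModule) (V := R_NormedModule)); simpl.
  - apply (is_RInt_minus (V := R_NormedModule)); now apply (is_RInt_scal (V := R_NormedModule)).
  - apply (is_RInt_plus (V := R_NormedModule)); now apply (is_RInt_scal (V := R_NormedModule)).
Qed.

Lemma is_CRInt_minus (f g : R -> C) (a b : R) (l m : C) :
  is_CRInt f a b l -> is_CRInt g a b m -> is_CRInt (fun t => (f t - g t)%C) a b (l - m)%C.
Proof. intros Hf Hg. exact (is_RInt_minus (V := C_R_NormedModule) _ _ _ _ _ _ Hf Hg). Qed.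

Lemma is_CRInt_const (c : C) (a b : R) :
  is_CRInt (fun _ => c) a b (RtoC (b - a) * c)%C.
Proof.
  rewrite <- scal_R_Cmult. exact (is_RInt_const (V := C_R_NormedModule) a b c).
Qed.

Lemma is_CRInt_unique (f : R -> C) (a b : R) (l m : C) :
  is_CRInt f a b l -> is_CRInt f a b m -> l = m.
Proof.
  intros Hl Hm.
  transitivity (@RInt C_R_CompleteNormedModule f a b); [ symmetry | ];
  now apply (is_RInt_unique (V := C_R_CompleteNormedModule)).
Qed.

Lemma Cmod_is_CRInt_le (f : R -> C) (a b : R) (l : C) (M : R) :
  a <= b -> (forall t, a <= t <= b -> Cmod (f t) <= M) -> is_CRInt f a b l ->
  Cmod l <= (b - a) * M.
Proof.
  intros Hab HM Hl. rewrite <- norm_CR.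
  apply (norm_RInt_le_const (V := C_R_NormedModule) f); [ exact Hab | | exact Hl ].
  intros t Ht. rewrite norm_CR. auto.
Qed.

Definition CRInt (f : R -> C) (a b : R) : C := @RInt C_R_CompleteNormedModule f a b.

Lemma CRInt_correct (f : R -> C) (a b : R) :
  a <= b -> (forall t, a <= t <= b -> RC_continuous f t) -> is_CRInt f a b (CRInt f a b).
Proof.
  intros Hab Hf. apply (RInt_correct (V := C_R_CompleteNormedModule)).
  apply (ex_RInt_continuous (V := C_R_CompleteNormedModule)).
  rewrite Rmin_left, Rmax_right by lra. exact Hf.
Qed.

Lemma is_CRInt_derive (f df : R -> C) (a b : R) :
  a <= b ->
  (forall t, a <= t <= b -> is_RC_derive f t (df t)) ->
  (forall t, a <= t <= b -> RC_continuous df t) ->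
  is_CRInt df a b (f b - f a)%C.
Proof.
  intros Hab Hf Hdf.
  apply (is_RInt_derive (V := C_R_CompleteNormedModule) f df); rewrite Rmin_left, Rmax_right by lra;
  assumption.
Qed.

(** * Goursat's lemma *)

Definition seg (a b : C) (t : R) : C := (a + RtoC t * (b - a))%C.

Definition seg_int (f : C -> C) (a b : C) : C :=
  ((b - a) * CRInt (fun t => f (seg a b t)) 0 1)%C.

Definition convex (K : C -> Prop) : Prop :=
  forall a b t, K a -> K b -> 0 <= t <= 1 -> K (seg a b t).

Lemma is_RC_derive_seg (a b : C) (t : R) : is_RC_derive (seg a b) t (b - a)%C.
Proof.
  apply is_RC_derive_eps. intros eps Heps. exists 1. split; [ lra | ].
  intros s _. unfold seg.
  replace (a + RtoC (t + s) * (b - a) - (a + RtoC t * (b - a)) - RtoC s * (b - a))%C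
    with (RtoC 0) by (rewrite RtoC_plus; ring).
  rewrite Cmod_0. apply Rmult_le_pos; [ lra | apply Rabs_pos ].
Qed.

Lemma RC_continuous_seg (f : C -> C) (a b : C) (t : R) :
  C_continuous f (seg a b t) -> RC_continuous (fun s => f (seg a b s)) t.
Proof.
  intros H. apply (continuous_comp (seg a b) f); [ | exact H ].
  eapply is_RC_derive_continuous. apply is_RC_derive_seg.
Qed.

Definition seg_continuous (f : C -> C) (a b : C) : Prop :=
  forall t, 0 <= t <= 1 -> C_continuous f (seg a b t).

Lemma convex_seg_continuous (K : C -> Prop) (f : C -> C) (a b : C) :
  convex K -> (forall w, K w -> C_continuous f w) -> K a -> K b -> seg_continuous f a b.
Proof. intros HK Hf Ha Hb t Ht. apply Hf. now apply HK. Qed.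

Lemma seg_int_correct (f : C -> C) (a b : C) :
  seg_continuous f a b ->
  is_CRInt (fun t => ((b - a) * f (seg a b t))%C) 0 1 (seg_int f a b).
Proof.
  intros H. apply is_CRInt_Cmult, CRInt_correct; [ lra | ].
  intros t Ht. now apply RC_continuous_seg, H.
Qed.

Lemma seg_int_unique (f : C -> C) (a b l : C) :
  is_CRInt (fun t => ((b - a) * f (seg a b t))%C) 0 1 l ->
  seg_continuous f a b -> seg_int f a b = l.
Proof.
  intros Hl H. eapply is_CRInt_unique; [ now apply seg_int_correct | exact Hl ].
Qed.

Lemma seg_int_FTC (F f : C -> C) (a b : C) :
  (forall t, 0 <= t <= 1 -> is_C_derive F (seg a b t) (f (seg a b t))) ->
  seg_continuous f a b -> seg_int f a b = (F b - F a)%C.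
Proof.
  intros HF Hf. apply seg_int_unique; [ | exact Hf ].
  replace (F b - F a)%C with (F (seg a b 1) - F (seg a b 0))%C.
  2: { unfold seg. f_equal; [ | f_equal ]; f_equal; ring. }
  apply (is_CRInt_derive (fun t => F (seg a b t))); [ lra | | ].
  - intros t Ht. rewrite Cmult_comm. apply is_RC_derive_comp; [ now apply HF | ].
    apply is_RC_derive_seg.
  - intros t Ht. apply RC_continuous_mult; [ apply continuous_const | ].
    now apply RC_continuous_seg, Hf.
Qed.

Lemma seg_int_approx (f g : C -> C) (a b : C) (M : R) :
  seg_continuous f a b -> seg_continuous g a b ->
  (forall t, 0 <= t <= 1 -> Cmod (f (seg a b t) - g (seg a b t)) <= M) ->
  Cmod (seg_int f a b - seg_int g a b) <= M * Cmod (b - a).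
Proof.
  intros Hf Hg HM.
  assert (H := is_CRInt_minus _ _ _ _ _ _ (seg_int_correct _ _ _ Hf) (seg_int_correct _ _ _ Hg)).
  replace (M * Cmod (b - a)) with ((1 - 0) * (M * Cmod (b - a))) by ring.
  refine (Cmod_is_CRInt_le _ 0 1 _ _ _ _ H); [ lra | ].
  intros t Ht. simpl.
  replace ((b - a) * f (seg a b t) - (b - a) * g (seg a b t))%C
    with ((f (seg a b t) - g (seg a b t)) * (b - a))%C by ring.
  rewrite Cmod_mult. apply Rmult_le_compat_r; [ apply Cmod_ge_0 | auto ].
Qed.

Lemma seg_int_const (k a b : C) : seg_int (fun _ => k) a b = ((b - a) * k)%C.
Proof.
  apply seg_int_unique.
  - assert (H := is_CRInt_const ((b - a) * k) 0 1).
    replace (RtoC (1 - 0) * ((b - a) * k))%C with ((b - a) * k)%C in H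
      by (rewrite RtoC_minus; ring).
    exact H.
  - intros t Ht. apply continuous_const.
Qed.

(** With [k = f a] this is the remainder estimate used both to differentiate a primitive and to make
    difference quotients uniform. *)
Lemma seg_int_near (f : C -> C) (a b k : C) (M : R) :
  seg_continuous f a b ->
  (forall t, 0 <= t <= 1 -> Cmod (f (seg a b t) - k) <= M) ->
  Cmod (seg_int f a b - (b - a) * k) <= M * Cmod (b - a).
Proof.
  intros Hf HM. rewrite <- seg_int_const. apply seg_int_approx; try assumption.
  intros t Ht. apply continuous_const.
Qed.

Lemma seg_int_bound (f : C -> C) (a b : C) (M : R) :
  seg_continuous f a b ->
  (forall t, 0 <= t <= 1 -> Cmod (f (seg a b t)) <= M) ->
  Cmod (seg_int f a b) <= M * Cmod (b - a).
Proof.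
  intros Hf HM.
  replace (seg_int f a b) with (seg_int f a b - (b - a) * 0)%C by ring.
  apply seg_int_near; [ exact Hf | ]. intros t Ht.
  replace (f (seg a b t) - 0)%C with (f (seg a b t)) by ring. auto.
Qed.

Lemma seg_int_swap (f : C -> C) (a b : C) :
  seg_continuous f a b -> seg_int f b a = (- seg_int f a b)%C.
Proof.
  intros Hf.
  assert (Hc : seg_continuous f b a).
  { intros t Ht. replace (seg b a t) with (seg a b (1 - t)).
    - apply Hf; lra.
    - unfold seg. rewrite RtoC_minus. ring. }
  apply seg_int_unique; [ | exact Hc ].
  assert (H := seg_int_correct _ _ _ Hf).
  apply (is_RInt_swap (V := C_R_NormedModule)) in H.
  (* The end points are written as values of [-1 * t + 1], so that the rule for linear substitutions
     applies. *)
  assert (H' : is_CRInt (fun t => ((b - a) * f (seg a b t))%C) (-1 * 0 + 1) (-1 * 1 + 1)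
     (- seg_int f a b)%C).
  { replace (-1 * 0 + 1) with 1 by ring. replace (-1 * 1 + 1) with 0 by ring. exact H. }
  apply (is_RInt_comp_lin (V := C_R_NormedModule)) in H'.
  revert H'. apply (is_RInt_ext (V := C_R_NormedModule)). intros t _.
  rewrite scal_R_Cmult. replace (seg b a t) with (seg a b (-1 * t + 1)).
  - replace (RtoC (-1)) with (- RtoC 1)%C by (rewrite <- RtoC_opp; reflexivity). Cring.
  - unfold seg. rewrite RtoC_plus, RtoC_mult. ring.
Qed.

Definition mid (a b : C) : C := seg a b (1 / 2).

Lemma seg_mid_l (a b : C) (t : R) : seg a (mid a b) t = seg a b (/ 2 * t + 0).
Proof.
  unfold mid, seg. rewrite Rplus_0_r, RtoC_mult.
  replace (1 / 2) with (/ 2) by field. ring.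
Qed.

Lemma seg_mid_r (a b : C) (t : R) : seg (mid a b) b t = seg a b (/ 2 * t + / 2).
Proof.
  unfold mid, seg. rewrite RtoC_plus, RtoC_mult.
  replace (1 / 2) with (/ 2) by field. rewrite RtoC_inv by lra. field.
Qed.

Lemma mid_minus_l (a b : C) : (mid a b - a)%C = (RtoC (/ 2) * (b - a))%C.
Proof. unfold mid, seg. replace (1 / 2) with (/ 2) by field. ring. Qed.

Lemma mid_minus_r (a b : C) : (b - mid a b)%C = (RtoC (/ 2) * (b - a))%C.
Proof.
  unfold mid, seg. replace (1 / 2) with (1 - / 2) by field. rewrite RtoC_minus. ring.
Qed.

Lemma seg_int_mid (f : C -> C) (a b : C) :
  seg_continuous f a b ->
  seg_int f a b = (seg_int f a (mid a b) + seg_int f (mid a b) b)%C.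
Proof.
  intros Hf.
  set (g := fun t => ((b - a) * f (seg a b t))%C).
  assert (Hg : forall t, 0 <= t <= 1 -> RC_continuous g t).
  { intros t Ht. apply RC_continuous_mult; [ apply continuous_const | ].
    now apply RC_continuous_seg, Hf. }
  apply seg_int_unique; [ | exact Hf ].
  apply (is_RInt_Chasles (V := C_R_NormedModule)) with (/ 2).
  - assert (H : is_CRInt g (/ 2 * 0 + 0) (/ 2 * 1 + 0) (CRInt g 0 (/ 2))).
    { replace (/ 2 * 0 + 0) with 0 by ring. replace (/ 2 * 1 + 0) with (/ 2) by ring.
      apply CRInt_correct; [ lra | ]. intros t Ht; apply Hg; lra. }
    replace (seg_int f a (mid a b)) with (CRInt g 0 (/ 2)).
    + apply CRInt_correct; [ lra | ]. intros t Ht; apply Hg; lra.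
    + symmetry. apply seg_int_unique.
      * apply (is_RInt_comp_lin (V := C_R_NormedModule)) in H.
        revert H. apply (is_RInt_ext (V := C_R_NormedModule)). intros t _.
        rewrite scal_R_Cmult, seg_mid_l, mid_minus_l. unfold g. Cring.
      * intros t Ht. rewrite seg_mid_l. apply Hf. lra.
  - assert (H : is_CRInt g (/ 2 * 0 + / 2) (/ 2 * 1 + / 2) (CRInt g (/ 2) 1)).
    { replace (/ 2 * 0 + / 2) with (/ 2) by ring. replace (/ 2 * 1 + / 2) with 1 by field.
      apply CRInt_correct; [ lra | ]. intros t Ht; apply Hg; lra. }
    replace (seg_int f (mid a b) b) with (CRInt g (/ 2) 1).
    + apply CRInt_correct; [ lra | ]. intros t Ht; apply Hg; lra.
    + symmetry. apply seg_int_unique.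
      * apply (is_RInt_comp_lin (V := C_R_NormedModule)) in H.
        revert H. apply (is_RInt_ext (V := C_R_NormedModule)). intros t _.
        rewrite scal_R_Cmult, seg_mid_r, mid_minus_r. unfold g. Cring.
      * intros t Ht. rewrite seg_mid_r. apply Hf. lra.
Qed.

Definition tri_int (f : C -> C) (a b c : C) : C :=
  (seg_int f a b + seg_int f b c + seg_int f c a)%C.

Definition perim (a b c : C) : R := Cmod (b - a) + Cmod (c - b) + Cmod (a - c).

Lemma mid_eq (a b : C) : mid a b = ((a + b) / RtoC 2)%C.
Proof.
  unfold mid, seg. rewrite RtoC_div by lra. field.
Qed.

Lemma Cmod_half (z w : C) : (RtoC 2 * z)%C = w -> Cmod z = Cmod w / 2.
Proof.
  intros <-. rewrite Cmod_mult, Cmod_R, Rabs_right by lra. field.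
Qed.

(** Every side splits at its midpoint, and each side of the medial triangle is traversed once in
    each direction and cancels. *)
Lemma tri_int_mid (K : C -> Prop) (f : C -> C) (a b c : C) :
  convex K -> (forall w, K w -> C_continuous f w) -> K a -> K b -> K c ->
  tri_int f a b c =
    (tri_int f a (mid a b) (mid c a) + tri_int f (mid a b) b (mid b c)
     + tri_int f (mid c a) (mid b c) c + tri_int f (mid a b) (mid b c) (mid c a))%C.
Proof.
  intros HK Hf Ha Hb Hc.
  assert (Hm : forall x y, K x -> K y -> K (mid x y)).
  { intros x y Hx Hy. apply HK; try assumption. lra. }
  assert (Hs : forall x y, K x -> K y -> seg_continuous f x y).
  { intros x y Hx Hy. now apply convex_seg_continuous with K. }
  unfold tri_int.
  rewrite (seg_int_mid f a b), (seg_int_mid f b c), (seg_int_mid f c a) by auto.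
  rewrite (seg_int_swap f (mid a b) (mid c a)), (seg_int_swap f (mid b c) (mid a b)),
    (seg_int_swap f (mid c a) (mid b c)) by auto.
  ring.
Qed.

(** One of the four summands of [tri_int_mid] carries at least a quarter of the modulus. The bound
    on [a' - a] will make the first vertices of the iterated triangles converge. *)
Lemma triangle_bisection (K : C -> Prop) (f : C -> C) :
  convex K -> (forall w, K w -> C_continuous f w) ->
  forall a b c, K a -> K b -> K c ->
  exists a' b' c', K a' /\ K b' /\ K c' /\ perim a' b' c' = perim a b c / 2 /\
    Cmod (a' - a) <= perim a b c /\ Cmod (tri_int f a b c) <= 4 * Cmod (tri_int f a' b' c').
Proof.
  intros HK Hf a b c Ha Hb Hc.
  assert (Hm : forall x y, K x -> K y -> K (mid x y)).
  { intros x y Hx Hy. apply HK; try assumption. lra. }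
  assert (Hp1 := Cmod_ge_0 (b - a)). assert (Hp2 := Cmod_ge_0 (c - b)).
  assert (Hp3 := Cmod_ge_0 (a - c)).
  assert (E1 : Cmod (mid a b - a) = Cmod (b - a) / 2).
  { apply Cmod_half. rewrite mid_eq. field. }
  assert (E2 : Cmod (mid c a - a) = Cmod (a - c) / 2).
  { rewrite <- Cmod_opp. apply Cmod_half. rewrite mid_eq. field. }
  assert (HT := tri_int_mid K f a b c HK Hf Ha Hb Hc).
  set (T1 := tri_int f a (mid a b) (mid c a)) in HT.
  set (T2 := tri_int f (mid a b) b (mid b c)) in HT.
  set (T3 := tri_int f (mid c a) (mid b c) c) in HT.
  set (T4 := tri_int f (mid a b) (mid b c) (mid c a)) in HT.
  assert (HT' : Cmod (tri_int f a b c) <= Cmod T1 + Cmod T2 + Cmod T3 + Cmod T4).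
  { rewrite HT. repeat (eapply Rle_trans; [ apply Cmod_triangle | apply Rplus_le_compat_r ]).
    apply Rle_refl. }
  assert (Hcase : Cmod (tri_int f a b c) <= 4 * Cmod T1 \/ Cmod (tri_int f a b c) <= 4 * Cmod T2 \/
    Cmod (tri_int f a b c) <= 4 * Cmod T3 \/ Cmod (tri_int f a b c) <= 4 * Cmod T4) by lra.
  assert (Hper : forall p q r x y z, (RtoC 2 * (q - p))%C = x -> (RtoC 2 * (r - q))%C = y ->
     (RtoC 2 * (p - r))%C = z -> Cmod x + Cmod y + Cmod z = perim a b c ->
     perim p q r = perim a b c / 2).
  { intros p q r x y z Hx Hy Hz <-. unfold perim.
    rewrite (Cmod_half _ _ Hx), (Cmod_half _ _ Hy), (Cmod_half _ _ Hz). lra. }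
  destruct Hcase as [H | [H | [H | H]]].
  - exists a, (mid a b), (mid c a). repeat split; auto.
    + apply Hper with (b - a)%C (c - b)%C (a - c)%C; rewrite ?mid_eq; try field.
      reflexivity.
    + replace (a - a)%C with (RtoC 0) by ring. rewrite Cmod_0. unfold perim. lra.
  - exists (mid a b), b, (mid b c). repeat split; auto.
    + apply Hper with (b - a)%C (c - b)%C (a - c)%C; rewrite ?mid_eq; try field.
      reflexivity.
    + unfold perim. lra.
  - exists (mid c a), (mid b c), c. repeat split; auto.
    + apply Hper with (b - a)%C (c - b)%C (a - c)%C; rewrite ?mid_eq; try field.
      reflexivity.
    + unfold perim. lra.
  - exists (mid a b), (mid b c), (mid c a). repeat split; auto.
    (* The sides of the medial triangle, doubled, are the original sides with opposite signs. *)
    + apply Hper with (c - a)%C (a - b)%C (b - c)%C; rewrite ?mid_eq; try field.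
      unfold perim. rewrite <- (Cmod_opp (c - a)), <- (Cmod_opp (a - b)), <- (Cmod_opp (b - c)).
      replace (- (c - a))%C with (a - c)%C by ring. replace (- (a - b))%C with (b - a)%C by ring.
      replace (- (b - c))%C with (c - b)%C by ring. ring.
    + unfold perim. lra.
Qed.

(** The steps from [n] on add up to at most [2 * M / 2 ^ n], so the intervals of this radius about
    [u n] are nested; the supremum of their left ends [v n] lies in all of them. *)
Lemma dyadic_limit (u : nat -> R) (M : R) :
  (forall n, Rabs (u (S n) - u n) <= M / 2 ^ n) ->
  exists l, forall n, Rabs (u n - l) <= 2 * M / 2 ^ n.
Proof.
  intros Hu.
  assert (Hpow : forall n, 2 * M / 2 ^ S n = M / 2 ^ n).
  { intros n. simpl. field. apply pow_nonzero. lra. }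
  assert (HM : 0 <= M).
  { specialize (Hu O). simpl in Hu. assert (H := Rabs_pos (u 1%nat - u O)). lra. }
  assert (Hpos : forall n, 0 <= M / 2 ^ n).
  { intros n. apply Rdiv_le_0_compat; [ exact HM | apply pow_lt; lra ]. }
  set (v := fun n => u n - 2 * M / 2 ^ n). set (w := fun n => u n + 2 * M / 2 ^ n).
  assert (Hd : forall n, 2 * M / 2 ^ n = 2 * (M / 2 ^ n)).
  { intros n. field. apply pow_nonzero. lra. }
  assert (Hv : Un_growing v).
  { intros n. unfold v. rewrite Hpow, Hd. specialize (Hu n). apply Rabs_le_between in Hu. lra. }
  assert (Hw : Un_decreasing w).
  { intros n. unfold w. rewrite Hpow, Hd. specialize (Hu n). apply Rabs_le_between in Hu. lra. }
  assert (Hvw : forall m n, v m <= w n).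
  { intros m n. apply Rle_trans with (v (max m n)).
    - apply Rge_le, growing_prop; [ exact Hv | lia ].
    - apply Rle_trans with (w (max m n)).
      + unfold v, w. rewrite Hd. specialize (Hpos (max m n)). lra.
      + apply decreasing_prop; [ exact Hw | lia ]. }
  destruct (completeness (fun x => exists n, x = v n)) as [l [Hl1 Hl2]].
  - exists (w O). intros x [n ->]. apply Hvw.
  - exists (v O). now exists O.
  - exists l. intros n. apply Rabs_le_between. split.
    + assert (l <= w n) by (apply Hl2; intros x [m ->]; apply Hvw). unfold w in *. lra.
    + assert (v n <= l) by (apply Hl1; now exists n). unfold v in *. lra.
Qed.

Lemma dyadic_limit_C (u : nat -> C) (M : R) :
  (forall n, Cmod (u (S n) - u n) <= M / 2 ^ n) ->
  exists l, forall n, Cmod (u n - l) <= 4 * M / 2 ^ n.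
Proof.
  intros Hu.
  destruct (dyadic_limit (fun n => fst (u n)) M) as [x Hx].
  { intros n. eapply Rle_trans; [ | apply (Hu n) ].
    exact (Cmod_fst_le (u (S n) - u n)). }
  destruct (dyadic_limit (fun n => snd (u n)) M) as [y Hy].
  { intros n. eapply Rle_trans; [ | apply (Hu n) ].
    exact (Cmod_snd_le (u (S n) - u n)). }
  exists (x, y). intros n. eapply Rle_trans; [ apply Cmod_le_abs | ].
  specialize (Hx n). specialize (Hy n).
  replace (4 * M / 2 ^ n) with (2 * M / 2 ^ n + 2 * M / 2 ^ n).
  - apply Rplus_le_compat; assumption.
  - field. apply pow_nonzero. lra.
Qed.

(** The affine part [A] of [f] at [p] has the primitive [P], so it integrates to zero around the
    triangle and only the remainder, of size [eps * D], is left. The disc of radius [perim a b c]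
    about [a] contains all three sides. *)
Lemma tri_int_local_bound (f : C -> C) (a b c p l : C) (eps D : R) :
  0 <= eps ->
  seg_continuous f a b -> seg_continuous f b c -> seg_continuous f c a ->
  (forall w, Cmod (w - a) <= perim a b c ->
     Cmod (w - p) <= D /\ Cmod (f w - f p - l * (w - p)) <= eps * Cmod (w - p)) ->
  Cmod (tri_int f a b c) <= eps * D * perim a b c.
Proof.
  intros Heps Hab Hbc Hca Hloc.
  set (A := fun w => (f p + l * (w - p))%C).
  set (P := fun w => ((f p - l * p) * w + l / RtoC 2 * (w * w))%C).
  assert (HP : forall w, is_C_derive P w (A w)).
  { intros w. apply is_C_derive_eps. intros e He.
    assert (Hl := Cmod_ge_0 (l / RtoC 2)).
    exists (e / (Cmod (l / RtoC 2) + 1)). split; [ apply Rdiv_lt_0_compat; lra | ].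
    intros h Hh. unfold P, A.
    match goal with |- Cmod ?x <= _ => replace x with (l / RtoC 2 * h * h)%C end.
    2: { field. }
    rewrite !Cmod_mult. apply Rmult_le_compat_r; [ apply Cmod_ge_0 | ].
    apply (Rmult_lt_compat_r (Cmod (l / RtoC 2) + 1)) in Hh; [ | lra ].
    unfold Rdiv in Hh. rewrite Rmult_assoc, Rinv_l in Hh by lra.
    assert (Hh0 := Cmod_ge_0 h). nra. }
  assert (HAc : forall w, C_continuous A w).
  { intros w. apply C_continuous_eps. intros e He.
    assert (Hl := Cmod_ge_0 l).
    exists (e / (Cmod l + 1)). split; [ apply Rdiv_lt_0_compat; lra | ].
    intros v Hv. unfold A.
    replace (f p + l * (v - p) - (f p + l * (w - p)))%C with (l * (v - w))%C by ring.
    rewrite Cmod_mult.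
    apply (Rmult_lt_compat_r (Cmod l + 1)) in Hv; [ | lra ].
    unfold Rdiv in Hv. rewrite Rmult_assoc, Rinv_l in Hv by lra.
    assert (H0 := Cmod_ge_0 (v - w)). nra. }
  assert (HA : forall x y, seg_continuous A x y) by (intros x y t _; apply HAc).
  assert (HF : forall x y, seg_int A x y = (P y - P x)%C).
  { intros x y. apply seg_int_FTC; [ intros; apply HP | apply HA ]. }
  assert (Hb1 := Cmod_ge_0 (b - a)). assert (Hb2 := Cmod_ge_0 (c - b)).
  assert (Hb3 := Cmod_ge_0 (a - c)).
  assert (Hside : forall x y, seg_continuous f x y ->
     (forall t, 0 <= t <= 1 -> Cmod (seg x y t - a) <= perim a b c) ->
     Cmod (seg_int f x y - seg_int A x y) <= eps * D * Cmod (y - x)).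
  { intros x y Hc Hn. apply seg_int_approx; auto. intros t Ht.
    destruct (Hloc _ (Hn t Ht)) as [H1 H2].
    unfold A. replace (f (seg x y t) - (f p + l * (seg x y t - p)))%C with
      (f (seg x y t) - f p - l * (seg x y t - p))%C by ring.
    eapply Rle_trans; [ exact H2 | ]. now apply Rmult_le_compat_l. }
  replace (tri_int f a b c) with ((seg_int f a b - seg_int A a b)
     + (seg_int f b c - seg_int A b c) + (seg_int f c a - seg_int A c a))%C.
  2: { rewrite !HF. unfold tri_int. ring. }
  unfold perim in *. rewrite !Rmult_plus_distr_l.
  assert (Ht1 : forall t z, 0 <= t <= 1 -> Cmod (RtoC t * z) <= Cmod z).
  { intros t z Ht. rewrite Cmod_mult, Cmod_R, Rabs_right by lra.
    assert (Hz := Cmod_ge_0 z). nra. }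
  eapply Rle_trans; [ apply Cmod_triangle | ]. apply Rplus_le_compat.
  - eapply Rle_trans; [ apply Cmod_triangle | ]. apply Rplus_le_compat.
    + apply Hside; [ exact Hab | ]. intros t Ht. unfold seg.
      replace (a + RtoC t * (b - a) - a)%C with (RtoC t * (b - a))%C by ring.
      specialize (Ht1 t (b - a)%C Ht). lra.
    + apply Hside; [ exact Hbc | ]. intros t Ht. unfold seg.
      replace (b + RtoC t * (c - b) - a)%C with ((b - a) + RtoC t * (c - b))%C by ring.
      specialize (Ht1 t (c - b)%C Ht).
      eapply Rle_trans; [ apply Cmod_triangle | ]. lra.
  - apply Hside; [ exact Hca | ]. intros t Ht. unfold seg.
    replace (c + RtoC t * (a - c) - a)%C with (- (RtoC (1 - t) * (a - c)))%C
      by (rewrite RtoC_minus; ring).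
    rewrite Cmod_opp. specialize (Ht1 (1 - t) (a - c)%C ltac:(lra)). lra.
Qed.

Definition Cclosed (K : C -> Prop) : Prop :=
  forall p, (forall eps, 0 < eps -> exists w, K w /\ Cmod (w - p) < eps) -> K p.

(** Each bisection costs a factor 4, which the local bound, quadratic in the perimeter, exactly
    compensates; so [tau <= eps * (5 * P * P)] for each [eps > 0]. *)
Theorem goursat (K : C -> Prop) (f : C -> C) (a b c : C) :
  convex K -> Cclosed K -> (forall w, K w -> exists l, is_C_derive f w l) ->
  K a -> K b -> K c -> tri_int f a b c = RtoC 0.
Proof.
  intros HK Hcl Hf Ha Hb Hc.
  assert (Hfc : forall w, K w -> C_continuous f w).
  { intros w Hw. destruct (Hf w Hw) as [l Hl]. now apply is_C_derive_continuous with l. }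
  set (P := perim a b c). set (tau := Cmod (tri_int f a b c)).
  set (v1 := fun s : C * C * C => fst (fst s)).
  set (v2 := fun s : C * C * C => snd (fst s)).
  set (v3 := fun s : C * C * C => snd s).
  set (inK := fun s => K (v1 s) /\ K (v2 s) /\ K (v3 s)).
  set (per := fun s => perim (v1 s) (v2 s) (v3 s)).
  set (T := fun s => Cmod (tri_int f (v1 s) (v2 s) (v3 s))).
  (* A triple outside [K] is sent to itself, which makes the step total, so that choice gives a
     function to iterate. *)
  assert (Hstep : forall s, exists s', inK s -> inK s' /\ per s' = per s / 2 /\
     Cmod (v1 s' - v1 s) <= per s /\ T s <= 4 * T s').
  { intros s. destruct (classic (inK s)) as [(H1 & H2 & H3) | Hn].
    - destruct (triangle_bisection K f HK Hfc _ _ _ H1 H2 H3) as (a' & b' & c' & H).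
      exists (a', b', c'). intros _. unfold inK, per, T; simpl. tauto.
    - exists s. tauto. }
  set (next := fun s => proj1_sig (constructive_indefinite_description _ (Hstep s))).
  assert (Hnext : forall s, inK s -> inK (next s) /\ per (next s) = per s / 2 /\
     Cmod (v1 (next s) - v1 s) <= per s /\ T s <= 4 * T (next s)).
  { intros s. unfold next. apply proj2_sig. }
  set (u := fun n => Nat.iter n next (a, b, c)).
  assert (Hu : forall n, inK (u n) /\ per (u n) = P / 2 ^ n /\ tau <= 4 ^ n * T (u n)).
  { induction n as [ | n [IH1 [IH2 IH3]] ].
    - split; [ repeat split; assumption | ]. split.
      + change (P = P / 1). field.
      + change (tau <= 1 * tau). lra.
    - destruct (Hnext _ IH1) as (H1 & H2 & H3 & H4). change (u (S n)) with (next (u n)).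
      split; [ exact H1 | ]. split.
      + rewrite H2, IH2. simpl. field. apply pow_nonzero; lra.
      + assert (0 <= 4 ^ n) by (apply pow_le; lra). eapply Rle_trans; [ exact IH3 | ].
        replace (4 ^ S n * T (next (u n))) with (4 ^ n * (4 * T (next (u n)))) by (simpl; ring).
        now apply Rmult_le_compat_l. }
  destruct (dyadic_limit_C (fun n => v1 (u n)) P) as [p Hp].
  { intros n. destruct (Hu n) as (H1 & H2 & _). rewrite <- H2. now apply Hnext. }
  assert (HP : 0 <= P).
  { unfold P, perim. assert (Hb1 := Cmod_ge_0 (b - a)). assert (Hb2 := Cmod_ge_0 (c - b)).
    assert (Hb3 := Cmod_ge_0 (a - c)). lra. }
  (* The factor 5 is 4 for the distance from the first vertex to the limit [p], plus 1 for the
     distance from that vertex to a point of the triangle. *)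
  assert (Hsmall : forall d, 0 < d -> exists n, 5 * P / 2 ^ n < d).
  { intros d Hd.
    destruct (pow_lt_1_zero (/ 2) ltac:(rewrite Rabs_right; lra) (d / (5 * P + 1))) as [n Hn].
    { apply Rdiv_lt_0_compat; lra. }
    exists n. specialize (Hn n (Nat.le_refl n)).
    rewrite pow_inv, Rabs_right in Hn.
    2: { apply Rle_ge, Rlt_le, Rinv_0_lt_compat, pow_lt; lra. }
    apply (Rmult_lt_compat_r (5 * P + 1)) in Hn; [ | lra ].
    unfold Rdiv in Hn. rewrite (Rmult_assoc d), Rinv_l in Hn by lra.
    assert (0 < / 2 ^ n) by (apply Rinv_0_lt_compat, pow_lt; lra).
    unfold Rdiv. nra. }
  assert (Hpos : forall n, 0 <= P / 2 ^ n).
  { intros n. apply Rdiv_le_0_compat; [ exact HP | apply pow_lt; lra ]. }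
  assert (Hdiv : forall k n, k * P / 2 ^ n = k * (P / 2 ^ n)).
  { intros k n. field. apply pow_nonzero. lra. }
  assert (HKp : K p).
  { apply Hcl. intros eps Heps. destruct (Hsmall eps Heps) as [n Hn].
    exists (v1 (u n)). split; [ apply Hu | ].
    eapply Rle_lt_trans; [ apply Hp | ]. rewrite Hdiv in *. specialize (Hpos n). lra. }
  apply Cmod_eq_0. fold tau. apply NNPP. intros Htau.
  assert (Htau' : 0 < tau).
  { assert (H := Cmod_ge_0 (tri_int f a b c)). fold tau in H. lra. }
  destruct (Hf p HKp) as [l Hl]. rewrite is_C_derive_eps in Hl.
  (* The summand 1 makes [eps * (5 * P * P)] strictly smaller than [tau], and keeps the denominator
     positive when [P = 0]. *)
  set (eps := tau / (5 * P * P + 1)).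
  assert (Hden : 0 < 5 * P * P + 1) by nra.
  assert (Heps : 0 < eps) by now apply Rdiv_lt_0_compat.
  destruct (Hl eps Heps) as [d [Hd Hloc]].
  destruct (Hsmall d Hd) as [n Hn].
  destruct (Hu n) as ((K1 & K2 & K3) & Hper & HT).
  specialize (Hp n). specialize (Hpos n). rewrite Hdiv in Hp, Hn.
  assert (Hbound : T (u n) <= eps * (5 * (P / 2 ^ n)) * (P / 2 ^ n)).
  { rewrite <- Hper at 2. unfold T, per.
    assert (Hs : forall x y, K x -> K y -> seg_continuous f x y).
    { intros x y Hx Hy. now apply convex_seg_continuous with K. }
    apply tri_int_local_bound with p l; auto; [ lra | ].
    intros w Hw. change (Cmod (w - v1 (u n)) <= per (u n)) in Hw. rewrite Hper in Hw.
    assert (Hwp : Cmod (w - p) <= 5 * (P / 2 ^ n)).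
    { replace (w - p)%C with ((w - v1 (u n)) + (v1 (u n) - p))%C by ring.
      eapply Rle_trans; [ apply Cmod_triangle | ]. simpl in Hp. lra. }
    split; [ exact Hwp | ].
    specialize (Hloc (w - p)%C ltac:(lra)).
    now replace (p + (w - p))%C with w in Hloc by ring. }
  assert (H4 : 0 < 4 ^ n) by (apply pow_lt; lra).
  assert (Hfin : tau <= eps * (5 * P * P)).
  { eapply Rle_trans; [ exact HT | ].
    apply Rle_trans with (4 ^ n * (eps * (5 * (P / 2 ^ n)) * (P / 2 ^ n))).
    - apply Rmult_le_compat_l; lra.
    - right. replace (4 ^ n) with (2 ^ n * 2 ^ n)
        by (rewrite <- Rpow_mult_distr; f_equal; ring).
      field. apply pow_nonzero; lra. }
  assert (Htau2 : eps * (5 * P * P + 1) = tau) by (unfold eps; field; lra).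
  lra.
Qed.

(** * Derivatives of holomorphic functions *)

Definition Cdisc (c : C) (r : R) (w : C) : Prop := Cmod (w - c) <= r.

Lemma Cdisc_convex (c : C) (r : R) : convex (Cdisc c r).
Proof.
  intros a b t Ha Hb Ht. unfold Cdisc, seg in *.
  replace (a + RtoC t * (b - a) - c)%C with (RtoC (1 - t) * (a - c) + RtoC t * (b - c))%C
    by (rewrite RtoC_minus; ring).
  eapply Rle_trans; [ apply Cmod_triangle | ].
  rewrite !Cmod_mult, !Cmod_R, !Rabs_right by lra. nra.
Qed.

Lemma Cdisc_closed (c : C) (r : R) : Cclosed (Cdisc c r).
Proof.
  intros p Hp. unfold Cdisc in *. apply Rnot_lt_le. intros Hlt.
  destruct (Hp (Cmod (p - c) - r)) as [w [Hw1 Hw2]]; [ lra | ].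
  rewrite <- Cmod_opp in Hw2.
  assert (H := Cmod_triangle (w - c) (- (w - p))%C).
  replace (w - c + - (w - p))%C with (p - c)%C in H by ring. lra.
Qed.

Lemma seg_minus_le (a h : C) (t : R) :
  0 <= t <= 1 -> Cmod (seg a (a + h) t - a) <= Cmod h.
Proof.
  intros Ht. unfold seg. replace (a + RtoC t * (a + h - a) - a)%C with (RtoC t * h)%C by ring.
  rewrite Cmod_mult, Cmod_R, Rabs_right by lra. assert (H := Cmod_ge_0 h). nra.
Qed.

(** By Goursat on the triangle [c, z, z + h], the increment of the integral from [c] is the integral
    over the segment from [z] to [z + h], which continuity of [f] at [z] compares with [f z * h]. *)
Lemma holomorphic_primitive (f : C -> C) (c : C) (r : R) :
  (forall w, Cdisc c r w -> exists l, is_C_derive f w l) ->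
  forall z, Cmod (z - c) < r -> is_C_derive (seg_int f c) z (f z).
Proof.
  intros Hf z Hz.
  assert (Hfc : forall w, Cdisc c r w -> C_continuous f w).
  { intros w Hw. destruct (Hf w Hw) as [l Hl]. now apply is_C_derive_continuous with l. }
  assert (Hconv := Cdisc_convex c r).
  apply is_C_derive_eps. intros eps Heps.
  assert (Hzd : Cdisc c r z) by (unfold Cdisc; lra).
  assert (Hcz := proj1 (C_continuous_eps f z) (Hfc z Hzd) eps Heps).
  destruct Hcz as [d [Hd Hcz]].
  exists (Rmin d (r - Cmod (z - c))). split; [ apply Rmin_glb_lt; lra | ].
  intros h Hh.
  assert (Hh1 := Rlt_le_trans _ _ _ Hh (Rmin_l _ _)).
  assert (Hh2 := Rlt_le_trans _ _ _ Hh (Rmin_r _ _)).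
  assert (Hzh : Cdisc c r (z + h)).
  { unfold Cdisc. replace (z + h - c)%C with ((z - c) + h)%C by ring.
    eapply Rle_trans; [ apply Cmod_triangle | ]. lra. }
  assert (Hcc : Cdisc c r c).
  { unfold Cdisc. replace (c - c)%C with (RtoC 0) by ring. rewrite Cmod_0.
    assert (H0 := Cmod_ge_0 (z - c)). lra. }
  assert (HG := goursat _ f c z (z + h)%C Hconv (Cdisc_closed c r) Hf Hcc Hzd Hzh).
  unfold tri_int in HG.
  rewrite (seg_int_swap f c (z + h)%C) in HG
    by now apply convex_seg_continuous with (Cdisc c r).
  replace (seg_int f c (z + h) - seg_int f c z - f z * h)%C
    with (seg_int f z (z + h) - (z + h - z) * f z)%C.
  2: { replace (seg_int f c (z + h)) with (seg_int f c z + seg_int f z (z + h))%C; [ ring | ].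
       apply Ceq_minus. rewrite <- HG. ring. }
  replace (Cmod h) with (Cmod (z + h - z)) by (f_equal; ring).
  apply seg_int_near; [ now apply convex_seg_continuous with (Cdisc c r) | ].
  intros t Ht. apply Rlt_le, Hcz. eapply Rle_lt_trans; [ now apply seg_minus_le | exact Hh1 ].
Qed.

(** A Lebesgue number argument on the square circumscribed about the disc of radius [r]. The square
    lies in the disc of radius [2 * r], which is why continuity is asked there. *)
Lemma uniform_continuity_disc (f : C -> C) (c : C) (r : R) :
  (forall w, Cdisc c (2 * r) w -> C_continuous f w) ->
  forall eps, 0 < eps -> exists d, 0 < d /\
    forall w w', Cdisc c r w -> Cmod (w' - w) < d -> Cmod (f w' - f w) <= eps.
Proof.
  intros Hf eps Heps.
  (* The factor 4 leaves room for both points: [w] is within [2 * delta p] of [p], one [delta p] per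
     coordinate, and [w'] is within a further [d <= delta p]. *)
  assert (Hd : forall p : C, exists d : posreal, Cdisc c (2 * r) p ->
     forall w, Cmod (w - p) < 4 * d -> Cmod (f w - f p) < eps / 2).
  { intros p. destruct (classic (Cdisc c (2 * r) p)) as [Hp | Hp].
    - destruct (proj1 (C_continuous_eps f p) (Hf p Hp) (eps / 2)) as [d [Hd H]]; [ lra | ].
      assert (Hd4 : 0 < d / 4) by lra.
      exists (mkposreal _ Hd4). intros _ w Hw. apply H. simpl in Hw. lra.
    - exists (mkposreal 1 Rlt_0_1). tauto. }
  set (delta := fun p => proj1_sig (constructive_indefinite_description _ (Hd p))).
  assert (Hdelta : forall p, Cdisc c (2 * r) p ->
     forall w, Cmod (w - p) < 4 * delta p -> Cmod (f w - f p) < eps / 2).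
  { intros p. unfold delta. apply proj2_sig. }
  destruct (compactness_value_2d (fst c - r) (fst c + r) (snd c - r) (snd c + r)
    (fun u v => delta (u, v))) as [d Hcomp].
  exists d. split; [ apply cond_pos | ]. intros w w' Hw Hw'. unfold Cdisc in Hw.
  assert (H1 := Cmod_fst_le (w - c)). assert (H2 := Cmod_snd_le (w - c)).
  simpl in H1, H2.
  assert (H1' := proj1 (Rabs_le_between _ _) (Rle_trans _ _ _ H1 Hw)).
  assert (H2' := proj1 (Rabs_le_between _ _) (Rle_trans _ _ _ H2 Hw)).
  destruct (NNPP _ (Hcomp (fst w) (snd w) ltac:(lra) ltac:(lra))) as (u & v & Hu & Hv & Hxu & Hyv & Hdd).
  set (p := (u, v) : C) in *.
  assert (Hp : Cdisc c (2 * r) p).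
  { unfold Cdisc. eapply Rle_trans; [ apply Cmod_le_abs | ]. simpl.
    assert (Rabs (u + - fst c) <= r) by (apply Rabs_le_between; lra).
    assert (Rabs (v + - snd c) <= r) by (apply Rabs_le_between; lra). lra. }
  assert (Hwp : Cmod (w - p) < 2 * delta p).
  { eapply Rle_lt_trans; [ apply Cmod_le_abs | ]. simpl. unfold Rminus in *. lra. }
  assert (Hwp' : Cmod (w' - p) < 4 * delta p).
  { replace (w' - p)%C with ((w' - w) + (w - p))%C by ring.
    assert (H0 := cond_pos (delta p)).
    eapply Rle_lt_trans; [ apply Cmod_triangle | ]. lra. }
  assert (H0 := cond_pos (delta p)).
  assert (G1 := Hdelta p Hp w ltac:(lra)). assert (G2 := Hdelta p Hp w' Hwp').
  rewrite <- Cmod_opp in G1.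
  replace (f w' - f w)%C with ((f w' - f p) + - (f w - f p))%C by ring.
  eapply Rle_trans; [ apply Cmod_triangle | ]. lra.
Qed.

(** The remainder is the integral of [f - f p] over the segment from [p] to [p + h], small uniformly
    in [p]. This uniformity is what allows differentiation under the circle integrals. *)
Lemma uniform_derivative_disc (F f : C -> C) (c : C) (r : R) :
  0 < r ->
  (forall w, Cdisc c (2 * r) w -> is_C_derive F w (f w)) ->
  (forall w, Cdisc c (2 * r) w -> C_continuous f w) ->
  forall eps, 0 < eps -> exists d, 0 < d /\
    forall p h, Cdisc c r p -> Cmod h < d ->
      Cmod (F (p + h) - F p - f p * h)%C <= eps * Cmod h.
Proof.
  intros Hr HF Hf eps Heps.
  destruct (uniform_continuity_disc f c r Hf eps Heps) as [d [Hd Huc]].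
  exists (Rmin d r). split; [ now apply Rmin_glb_lt | ].
  intros p h Hp Hh.
  assert (Hh1 := Rlt_le_trans _ _ _ Hh (Rmin_l _ _)).
  assert (Hh2 := Rlt_le_trans _ _ _ Hh (Rmin_r _ _)).
  assert (Hseg : forall t, 0 <= t <= 1 -> Cdisc c (2 * r) (seg p (p + h) t)).
  { intros t Ht. unfold Cdisc in *. assert (Hs := seg_minus_le p h t Ht).
    replace (seg p (p + h) t - c)%C with ((seg p (p + h) t - p) + (p - c))%C by ring.
    eapply Rle_trans; [ apply Cmod_triangle | ]. lra. }
  assert (Hsc : seg_continuous f p (p + h)) by (intros t Ht; auto).
  rewrite <- (seg_int_FTC F f p (p + h)%C) by auto.
  replace (f p * h)%C with ((p + h - p) * f p)%C by ring.
  replace (Cmod h) with (Cmod (p + h - p)) by (f_equal; ring).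
  apply seg_int_near; [ exact Hsc | ].
  intros t Ht. apply Huc; [ exact Hp | ].
  eapply Rle_lt_trans; [ now apply seg_minus_le | exact Hh1 ].
Qed.

(** * Circle integrals and mean values *)

Definition cis (x : R) : C := (cos x, sin x).

Lemma Cmod_cis (x : R) : Cmod (cis x) = 1.
Proof.
  unfold Cmod, cis; simpl. assert (H := sin2_cos2 x). unfold Rsqr in H.
  transitivity (sqrt 1); [ f_equal; lra | apply sqrt_1 ].
Qed.

Lemma is_RC_derive_cis (k x : R) :
  is_RC_derive (fun y => cis (k * y)) x (RtoC k * (Ci * cis (k * x)))%C.
Proof.
  rewrite (surjective_pairing (RtoC k * (Ci * cis (k * x)))%C).
  apply is_RC_derive_pair; simpl; auto_derive; auto; ring.
Qed.

Lemma RC_continuous_cis (k x : R) : RC_continuous (fun y => cis (k * y)) x.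
Proof. eapply is_RC_derive_continuous. apply is_RC_derive_cis. Qed.

Lemma cis_mult_opp (x : R) : (cis x * cis (- x))%C = RtoC 1.
Proof.
  unfold cis. rewrite cos_neg, sin_neg. unfold Cmult, RtoC; simpl.
  assert (H := sin2_cos2 x). unfold Rsqr in H. f_equal; [ rewrite <- H | ]; ring.
Qed.

(* The factor [1] makes [circ] an instance of the derivative rule for [cis (k * x)]. *)
Definition circ (z : C) (t x : R) : C := (z + RtoC t * cis (1 * x))%C.

Lemma is_RC_derive_circ (z : C) (t x : R) :
  is_RC_derive (circ z t) x (RtoC t * (Ci * cis (1 * x)))%C.
Proof.
  assert (H := is_RC_derive_eps (circ z t) x (RtoC t * (Ci * cis (1 * x)))%C).
  apply H. clear H. intros eps Heps.
  assert (Ht := Rabs_pos t).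
  assert (He : 0 < eps / (Rabs t + 1)) by (apply Rdiv_lt_0_compat; lra).
  destruct (proj1 (is_RC_derive_eps _ _ _) (is_RC_derive_cis 1 x) _ He) as [d [Hd H]].
  exists d. split; [ exact Hd | ]. intros s Hs. specialize (H s Hs). unfold circ.
  replace (z + RtoC t * cis (1 * (x + s)) - (z + RtoC t * cis (1 * x))
      - RtoC s * (RtoC t * (Ci * cis (1 * x))))%C
    with (RtoC t * (cis (1 * (x + s)) - cis (1 * x) - RtoC s * (RtoC 1 * (Ci * cis (1 * x)))))%C
    by ring.
  rewrite Cmod_mult, Cmod_R.
  apply Rle_trans with (Rabs t * (eps / (Rabs t + 1) * Rabs s)).
  - now apply Rmult_le_compat_l.
  - assert (Hs0 := Rabs_pos s).
    assert (eps / (Rabs t + 1) * (Rabs t + 1) = eps) by (field; lra).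
    assert (0 <= eps / (Rabs t + 1) * Rabs s) by (apply Rmult_le_pos; lra). nra.
Qed.

Lemma RC_continuous_circ (f : C -> C) (z : C) (t x : R) :
  C_continuous f (circ z t x) -> RC_continuous (fun y => f (circ z t y)) x.
Proof.
  intros H. apply (continuous_comp (circ z t) f); [ | exact H ].
  eapply is_RC_derive_continuous. apply is_RC_derive_circ.
Qed.

Lemma Cmod_circ_minus (z : C) (t x : R) : Cmod (circ z t x - z) = Rabs t.
Proof.
  unfold circ. replace (z + RtoC t * cis (1 * x) - z)%C with (RtoC t * cis (1 * x))%C by ring.
  rewrite Cmod_mult, Cmod_R, Cmod_cis. ring.
Qed.

Lemma Cdisc_circ (c z : C) (r t x : R) :
  Cmod (z - c) + Rabs t <= r -> Cdisc c r (circ z t x).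
Proof.
  intros H. unfold Cdisc. replace (circ z t x - c)%C with ((circ z t x - z) + (z - c))%C by ring.
  eapply Rle_trans; [ apply Cmod_triangle | ]. rewrite Cmod_circ_minus. lra.
Qed.

Lemma circ_2PI (z : C) (t : R) : circ z t (2 * PI) = circ z t 0.
Proof.
  unfold circ, cis. rewrite Rmult_1_l, Rmult_0_r, cos_2PI, sin_2PI, cos_0, sin_0. reflexivity.
Qed.

Lemma PI2_pos : 0 <= 2 * PI.
Proof. assert (H := PI_RGT_0). lra. Qed.

(* The primitive of [f * i t cis] along the circle is [F]; for [t = 0] the
   integral is computed directly. *)
Lemma circ_int_zero (F f : C -> C) (z : C) (t : R) (l : C) :
  (forall x, is_C_derive F (circ z t x) (f (circ z t x))) ->
  (forall x, C_continuous f (circ z t x)) ->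
  is_CRInt (fun x => (f (circ z t x) * cis (1 * x))%C) 0 (2 * PI) l -> l = RtoC 0.
Proof.
  intros HF Hf Hl. destruct (Req_dec t 0) as [-> | Ht].
  - assert (H1 : is_CRInt (fun x => (f z * (RtoC 1 * (Ci * cis (1 * x))))%C) 0 (2 * PI) (Ci * l)%C).
    { generalize (is_CRInt_Cmult Ci _ _ _ _ Hl).
      apply (is_RInt_ext (V := C_R_NormedModule)). intros x _.
      replace (circ z 0 x) with z by (unfold circ; ring). Cring. }
    assert (H2 : is_CRInt (fun x => (f z * (RtoC 1 * (Ci * cis (1 * x))))%C) 0 (2 * PI)
       (f z * (cis (1 * (2 * PI)) - cis (1 * 0)))%C).
    { apply is_CRInt_Cmult.
      apply (is_CRInt_derive (fun x => cis (1 * x)) (fun x => (RtoC 1 * (Ci * cis (1 * x)))%C));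
      [ apply PI2_pos | | ].
      - intros x _. apply is_RC_derive_cis.
      - intros x _. do 2 (apply RC_continuous_mult; [ apply continuous_const | ]).
        apply RC_continuous_cis. }
    assert (H := is_CRInt_unique _ _ _ _ _ H1 H2).
    assert (Hz : (Ci * l)%C = RtoC 0).
    { rewrite H. unfold cis. rewrite Rmult_1_l, Rmult_0_r, cos_2PI, sin_2PI, cos_0, sin_0. ring. }
    replace l with (- Ci * (Ci * l))%C.
    + rewrite Hz. ring.
    + apply injective_projections; simpl; ring.
  - assert (H1 := is_CRInt_Cmult (RtoC t * Ci)%C _ _ _ _ Hl).
    assert (H2 : is_CRInt (fun x => (f (circ z t x) * (RtoC t * (Ci * cis (1 * x))))%C) 0 (2 * PI)
       (F (circ z t (2 * PI)) - F (circ z t 0))%C).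
    { apply (is_CRInt_derive (fun x => F (circ z t x))); [ apply PI2_pos | | ].
      - intros x _. apply is_RC_derive_comp; [ apply HF | apply is_RC_derive_circ ].
      - intros x _. apply RC_continuous_mult; [ now apply RC_continuous_circ | ].
        do 2 (apply RC_continuous_mult; [ apply continuous_const | ]).
        apply RC_continuous_cis. }
    assert (Hz : (RtoC t * Ci * l)%C = RtoC 0).
    { rewrite circ_2PI in H2. transitivity (F (circ z t 0) - F (circ z t 0))%C; [ | ring ].
      refine (is_CRInt_unique _ _ _ _ _ H1 _). revert H2.
      apply (is_RInt_ext (V := C_R_NormedModule)). intros x _. Cring. }
    apply NNPP. intros Hl0.
    apply (Cmult_neq_0 (RtoC t * Ci) l); [ | exact Hl0 | exact Hz ].
    apply Cmult_neq_0; [ | exact Ci_nz ]. intros H. apply RtoC_inj in H. auto.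
Qed.

(** The integral [phi t] over the circle of radius [t] has derivative [int f * cis], which vanishes
    by [circ_int_zero]; so [phi r = phi 0]. The circles lie in the disc of radius [2 * r], and
    [uniform_derivative_disc] doubles this to [4 * r]. *)
Lemma mean_value_circ (F f : C -> C) (c z : C) (r : R) (l : C) :
  0 < r ->
  (forall w, Cdisc c (4 * r) w -> is_C_derive F w (f w)) ->
  (forall w, Cdisc c (4 * r) w -> C_continuous f w) ->
  Cdisc c r z ->
  is_CRInt (fun x => F (circ z r x)) 0 (2 * PI) l ->
  l = (RtoC (2 * PI) * F z)%C.
Proof.
  intros Hr HF Hf Hz Hl.
  assert (HFc : forall w, Cdisc c (4 * r) w -> C_continuous F w).
  { intros w Hw. apply is_C_derive_continuous with (f w); auto. }
  assert (H22 : 2 * (2 * r) = 4 * r) by ring.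
  set (phi := fun t => CRInt (fun x => F (circ z t x)) 0 (2 * PI)).
  assert (Hphi : forall t, Rabs t <= 3 * r -> is_CRInt (fun x => F (circ z t x)) 0 (2 * PI) (phi t)).
  { intros t Ht. apply CRInt_correct; [ apply PI2_pos | ]. intros x _.
    apply RC_continuous_circ, HFc, Cdisc_circ. unfold Cdisc in Hz. lra. }
  assert (Hder : forall t, 0 <= t <= r -> is_RC_derive phi t (RtoC 0)).
  { intros t Ht. apply is_RC_derive_eps. intros eps Heps.
    assert (HPI := PI_RGT_0).
    assert (He : 0 < eps / (2 * PI)) by (apply Rdiv_lt_0_compat; lra).
    destruct (uniform_derivative_disc F f c (2 * r)) with (eps := eps / (2 * PI))
      as [d [Hd Hud]]; try lra; try (rewrite H22; assumption).
    exists (Rmin d r). split; [ now apply Rmin_glb_lt | ]. intros s Hs.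
    assert (Hs1 := Rlt_le_trans _ _ _ Hs (Rmin_l _ _)).
    assert (Hs2 := Rlt_le_trans _ _ _ Hs (Rmin_r _ _)).
    assert (Hs3 := proj1 (Rabs_lt_between _ _) Hs2).
    assert (Hin : forall x, Cdisc c (2 * r) (circ z t x)).
    { intros x. apply Cdisc_circ. unfold Cdisc in Hz. rewrite Rabs_right by lra. lra. }
    assert (Hin4 : forall x, Cdisc c (4 * r) (circ z t x)).
    { intros x. specialize (Hin x). unfold Cdisc in *. lra. }
    assert (H1 := Hphi t ltac:(apply Rabs_le_between; lra)).
    assert (H2 := Hphi (t + s) ltac:(apply Rabs_le_between; lra)).
    set (J := CRInt (fun x => (f (circ z t x) * cis (1 * x))%C) 0 (2 * PI)).
    assert (HJ : is_CRInt (fun x => (f (circ z t x) * cis (1 * x))%C) 0 (2 * PI) J).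
    { apply CRInt_correct; [ apply PI2_pos | ]. intros x _.
      apply RC_continuous_mult; [ | apply RC_continuous_cis ].
      apply RC_continuous_circ; auto. }
    assert (HJ0 : J = RtoC 0) by (apply (circ_int_zero F f z t); auto).
    assert (H3 := is_CRInt_minus _ _ _ _ _ _ (is_CRInt_minus _ _ _ _ _ _ H2 H1)
      (is_CRInt_Cmult (RtoC s) _ _ _ _ HJ)).
    rewrite HJ0 in H3.
    replace (eps * Rabs s) with ((2 * PI - 0) * (eps / (2 * PI) * Rabs s)) by (field; lra).
    refine (Cmod_is_CRInt_le _ 0 (2 * PI) _ _ PI2_pos _ H3). intros x _. simpl.
    replace (Rabs s) with (Cmod (RtoC s * cis (1 * x))) by (rewrite Cmod_mult, Cmod_R, Cmod_cis; ring).
    replace (circ z (t + s) x) with (circ z t x + RtoC s * cis (1 * x))%C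
      by (unfold circ; rewrite RtoC_plus; ring).
    replace (RtoC s * (f (circ z t x) * cis (1 * x)))%C
      with (f (circ z t x) * (RtoC s * cis (1 * x)))%C by ring.
    apply Hud; [ apply Hin | ]. rewrite Cmod_mult, Cmod_R, Cmod_cis. lra. }
  assert (Heq : phi 0 = phi r).
  { apply (eq_is_derive (V := C_R_NormedModule)); [ exact Hder | exact Hr ]. }
  transitivity (phi r).
  { refine (is_CRInt_unique _ _ _ _ _ Hl (Hphi r _)). apply Rabs_le_between; lra. }
  rewrite <- Heq.
  refine (is_CRInt_unique _ _ _ _ _ (Hphi 0 _) _); [ apply Rabs_le_between; lra | ].
  assert (H := is_CRInt_const (F z) 0 (2 * PI)). rewrite Rminus_0_r in H.
  revert H. apply (is_RInt_ext (V := C_R_NormedModule)). intros x _.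
  replace (circ z 0 x) with z by (unfold circ; ring). reflexivity.
Qed.

(** At this stage [f] is only known to be continuous, so [mean_value_circ] does not apply to it.
    Instead the property of [F] at [z] and at [z + s] is subtracted, and divided by a small real
    [s]. *)
Lemma mean_value_circ_derive (F f : C -> C) (c z : C) (r : R) (l : C) :
  0 < r ->
  (forall w, Cdisc c (4 * r) w -> is_C_derive F w (f w)) ->
  (forall w, Cdisc c (4 * r) w -> C_continuous f w) ->
  Cmod (z - c) < r ->
  is_CRInt (fun x => f (circ z r x)) 0 (2 * PI) l ->
  l = (RtoC (2 * PI) * f z)%C.
Proof.
  intros Hr HF Hf Hz Hl.
  assert (HFc : forall w, Cdisc c (4 * r) w -> C_continuous F w).
  { intros w Hw. apply is_C_derive_continuous with (f w); auto. }
  assert (H22 : 2 * (2 * r) = 4 * r) by ring.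
  assert (HPI := PI_RGT_0).
  assert (Hmv : forall y, Cdisc c r y ->
    is_CRInt (fun x => F (circ y r x)) 0 (2 * PI) (RtoC (2 * PI) * F y)%C).
  { intros y Hy. set (m := CRInt (fun x => F (circ y r x)) 0 (2 * PI)).
    assert (Hm : is_CRInt (fun x => F (circ y r x)) 0 (2 * PI) m).
    { apply CRInt_correct; [ apply PI2_pos | ]. intros x _.
      apply RC_continuous_circ, HFc, Cdisc_circ. unfold Cdisc in Hy.
      rewrite Rabs_right; lra. }
    now rewrite <- (mean_value_circ F f c y r m). }
  apply Ceq_minus, Cmod_eq_0, Rle_antisym; [ | apply Cmod_ge_0 ].
  apply le_epsilon. intros e He.
  (* Two errors of size [2 * PI * eps * s] arise, one from the integral and one from the centre. *)
  set (eps := e / (4 * PI)).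
  assert (Heps : 0 < eps) by (apply Rdiv_lt_0_compat; lra).
  destruct (uniform_derivative_disc F f c (2 * r)) with (eps := eps)
      as [d [Hd Hud]]; try lra; try (rewrite H22; assumption).
  set (s := Rmin (d / 2) ((r - Cmod (z - c)) / 2)).
  assert (Hs0 : 0 < s) by (apply Rmin_glb_lt; lra).
  assert (Hs1 : s <= d / 2) by apply Rmin_l.
  assert (Hs2 : s <= (r - Cmod (z - c)) / 2) by apply Rmin_r.
  assert (Hms : Cmod s = s) by (rewrite Cmod_R, Rabs_right; lra).
  assert (Hzs : Cdisc c r (z + RtoC s)).
  { unfold Cdisc. replace (z + RtoC s - c)%C with ((z - c) + RtoC s)%C by ring.
    eapply Rle_trans; [ apply Cmod_triangle | ]. lra. }
  assert (Hzd : Cdisc c r z) by (unfold Cdisc; lra).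
  assert (H1 := is_CRInt_minus _ _ _ _ _ _
    (is_CRInt_minus _ _ _ _ _ _ (Hmv _ Hzs) (Hmv _ Hzd)) (is_CRInt_Cmult (RtoC s) _ _ _ _ Hl)).
  apply (Cmod_is_CRInt_le _ 0 (2 * PI) _ (eps * s) PI2_pos) in H1.
  2: { intros x _. simpl.
    replace (circ (z + RtoC s) r x) with (circ z r x + RtoC s)%C by (unfold circ; ring).
    rewrite (Cmult_comm (RtoC s)). rewrite <- Hms at 3.
    apply Hud; [ | lra ]. apply Cdisc_circ. rewrite Rabs_right; lra. }
  assert (H2 := Hud z (RtoC s) ltac:(unfold Cdisc; lra) ltac:(lra)).
  rewrite Hms in H2.
  assert (H3 : Cmod (RtoC s * (l - RtoC (2 * PI) * f z)) <= s * e).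
  { replace (RtoC s * (l - RtoC (2 * PI) * f z))%C with
      (- (RtoC (2 * PI) * F (z + RtoC s)%C - RtoC (2 * PI) * F z - RtoC s * l)
       + RtoC (2 * PI) * (F (z + RtoC s)%C - F z - f z * RtoC s))%C by ring.
    eapply Rle_trans; [ apply Cmod_triangle | ].
    rewrite Cmod_opp, (Cmod_mult (RtoC (2 * PI))), Cmod_R, Rabs_right by lra.
    apply Rle_trans with ((2 * PI - 0) * (eps * s) + 2 * PI * (eps * s)).
    - apply Rplus_le_compat; [ exact H1 | ]. apply Rmult_le_compat_l; lra.
    - right. unfold eps. field. lra. }
  rewrite Cmod_mult, Hms in H3. apply Rmult_le_reg_l in H3; [ lra | exact Hs0 ].
Qed.

(* Integrating the mean value property by parts expresses [f] through its
   primitive [F]; this formula can be differentiated in [z] under the integral. *)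
Lemma cauchy_formula_circ (F f : C -> C) (c z : C) (r : R) (l : C) :
  0 < r ->
  (forall w, Cdisc c (4 * r) w -> is_C_derive F w (f w)) ->
  (forall w, Cdisc c (4 * r) w -> C_continuous f w) ->
  Cmod (z - c) < r ->
  is_CRInt (fun x => (cis (-1 * x) * F (circ z r x))%C) 0 (2 * PI) l ->
  l = (RtoC (2 * PI * r) * f z)%C.
Proof.
  intros Hr HF Hf Hz Hl.
  assert (Hin : forall x, Cdisc c (4 * r) (circ z r x)).
  { intros x. apply Cdisc_circ. rewrite Rabs_right; lra. }
  set (m := CRInt (fun x => f (circ z r x)) 0 (2 * PI)).
  assert (Hm : is_CRInt (fun x => f (circ z r x)) 0 (2 * PI) m).
  { apply CRInt_correct; [ apply PI2_pos | ]. intros x _. apply RC_continuous_circ; auto. }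
  assert (Hmv := mean_value_circ_derive F f c z r m Hr HF Hf Hz Hm).
  assert (HFc : forall x, RC_continuous (fun y => F (circ z r y)) x).
  { intros x. apply RC_continuous_circ. apply is_C_derive_continuous with (f (circ z r x)); auto. }
  set (df := fun x => ((RtoC (-1) * (Ci * cis (-1 * x))) * F (circ z r x)
     + cis (-1 * x) * (f (circ z r x) * (RtoC r * (Ci * cis (1 * x)))))%C).
  (* The antiderivative [cis (- x) * F] is periodic, so the integral of [df] is zero; [H2] computes
     the same integral by means of [cis x * cis (- x) = 1]. *)
  assert (H1 : is_CRInt df 0 (2 * PI)
    (cis (-1 * (2 * PI)) * F (circ z r (2 * PI)) - cis (-1 * 0) * F (circ z r 0))%C).
  { apply (is_CRInt_derive (fun x => (cis (-1 * x) * F (circ z r x))%C)); [ apply PI2_pos | | ].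
    - intros x _.
      apply (is_RC_derive_mult (fun x => cis (-1 * x)) (fun x => F (circ z r x)));
      [ apply is_RC_derive_cis | ].
      apply is_RC_derive_comp; [ apply HF, Hin | apply is_RC_derive_circ ].
    - intros x _. apply (continuous_plus (V := C_R_NormedModule)).
      + apply RC_continuous_mult; [ | apply HFc ].
        do 2 (apply RC_continuous_mult; [ apply continuous_const | ]). apply RC_continuous_cis.
      + apply RC_continuous_mult; [ apply RC_continuous_cis | ].
        apply RC_continuous_mult; [ apply RC_continuous_circ; auto | ].
        do 2 (apply RC_continuous_mult; [ apply continuous_const | ]). apply RC_continuous_cis. }
  assert (H2 : is_CRInt df 0 (2 * PI) (Ci * (RtoC r * m - l))%C).
  { generalize (is_CRInt_Cmult Ci _ _ _ _
      (is_CRInt_minus _ _ _ _ _ _ (is_CRInt_Cmult (RtoC r) _ _ _ _ Hm) Hl)).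
    apply (is_RInt_ext (V := C_R_NormedModule)). intros x _. unfold df.
    assert (Hc := cis_mult_opp x).
    replace (-1 * x) with (- x) by ring. replace (1 * x) with x by ring.
    match goal with |- ?a = ?b => change (a = b :> C) end.
    transitivity (Ci * (RtoC r * (f (circ z r x) * (cis x * cis (- x)))
      - cis (- x) * F (circ z r x)))%C; [ rewrite Hc; ring | ring ]. }
  assert (H := is_CRInt_unique _ _ _ _ _ H1 H2).
  rewrite circ_2PI in H.
  replace (cis (-1 * (2 * PI))) with (cis (-1 * 0)) in H.
  2: { unfold cis. replace (-1 * (2 * PI)) with (- (2 * PI)) by ring. rewrite Rmult_0_r.
       now rewrite cos_neg, sin_neg, cos_2PI, sin_2PI, cos_0, sin_0, Ropp_0. }
  assert (H0 : (Ci * (RtoC r * m - l))%C = RtoC 0) by (rewrite <- H; ring).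
  assert (Hzero : (RtoC r * m - l)%C = RtoC 0).
  { apply NNPP. intros Hn. exact (Cmult_neq_0 _ _ Ci_nz Hn H0). }
  apply Ceq_minus in Hzero. rewrite <- Hzero, Hmv, !RtoC_mult. ring.
Qed.

(** In [f = k * avg F] the variable [z] only translates the argument of [F], so the derivative is
    [k * avg f], continuous by uniform continuity of [f]. Continuity of [l] is part of the
    conclusion so that the lemma applies again to [f, l]. *)
Lemma C1_derive (F f : C -> C) (c : C) (r : R) :
  0 < r ->
  (forall w, Cdisc c (4 * r) w -> is_C_derive F w (f w)) ->
  (forall w, Cdisc c (4 * r) w -> C_continuous f w) ->
  exists l : C -> C, forall z, Cmod (z - c) < r ->
    is_C_derive f z (l z) /\ C_continuous l z.
Proof.
  intros Hr HF Hf.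
  assert (HFc : forall w, Cdisc c (4 * r) w -> C_continuous F w).
  { intros w Hw. apply is_C_derive_continuous with (f w); auto. }
  assert (HPI := PI_RGT_0).
  assert (H22 : 2 * (2 * r) = 4 * r) by ring.
  assert (Hpr : 0 < 2 * PI * r) by (apply Rmult_lt_0_compat; lra).
  set (k := RtoC (/ (2 * PI * r))).
  assert (Hk : (k * RtoC (2 * PI * r))%C = RtoC 1).
  { unfold k. rewrite <- RtoC_mult, Rinv_l by lra. reflexivity. }
  assert (Hkm : Cmod k = / (2 * PI * r)).
  { unfold k. rewrite Cmod_R, Rabs_right; [ reflexivity | ].
    apply Rle_ge, Rlt_le, Rinv_0_lt_compat, Hpr. }
  set (avg := fun (g : C -> C) z => CRInt (fun x => (cis (-1 * x) * g (circ z r x))%C) 0 (2 * PI)).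
  assert (Hin : forall z x, Cmod (z - c) < r -> Cdisc c (2 * r) (circ z r x)).
  { intros z x Hz. apply Cdisc_circ. rewrite Rabs_right; lra. }
  assert (H24 : forall w, Cdisc c (2 * r) w -> Cdisc c (4 * r) w).
  { intros w Hw. unfold Cdisc in *. lra. }
  assert (Havg : forall g z, (forall w, Cdisc c (4 * r) w -> C_continuous g w) ->
     Cmod (z - c) < r ->
     is_CRInt (fun x => (cis (-1 * x) * g (circ z r x))%C) 0 (2 * PI) (avg g z)).
  { intros g z Hg Hz. apply CRInt_correct; [ apply PI2_pos | ]. intros x _.
    apply RC_continuous_mult; [ apply RC_continuous_cis | ].
    apply RC_continuous_circ, Hg, H24, Hin, Hz. }
  assert (Hform : forall z, Cmod (z - c) < r -> f z = (k * avg F z)%C).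
  { intros z Hz. rewrite (cauchy_formula_circ F f c z r (avg F z)) by auto.
    rewrite Cmult_assoc, Hk. ring. }
  assert (Hshift : forall h z x, circ (z + h) r x = (circ z r x + h)%C).
  { intros h z x. unfold circ. ring. }
  exists (fun z => (k * avg f z)%C). intros z Hz. split.
  - apply is_C_derive_eps. intros eps Heps.
    (* The factor [r] cancels the product of [Cmod k] with the length [2 * PI] of the interval. *)
    destruct (uniform_derivative_disc F f c (2 * r)) with (eps := eps * r)
      as [d [Hd Hud]]; try lra; try (rewrite H22; assumption).
    { now apply Rmult_lt_0_compat. }
    exists (Rmin d (r - Cmod (z - c))). split; [ apply Rmin_glb_lt; lra | ].
    intros h Hh.
    assert (Hh1 := Rlt_le_trans _ _ _ Hh (Rmin_l _ _)).
    assert (Hh2 := Rlt_le_trans _ _ _ Hh (Rmin_r _ _)).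
    assert (Hzh : Cmod (z + h - c) < r).
    { replace (z + h - c)%C with ((z - c) + h)%C by ring.
      eapply Rle_lt_trans; [ apply Cmod_triangle | ]. lra. }
    rewrite (Hform z Hz), (Hform _ Hzh).
    replace (k * avg F (z + h)%C - k * avg F z - k * avg f z * h)%C
      with (k * (avg F (z + h)%C - avg F z - h * avg f z))%C by ring.
    rewrite Cmod_mult, Hkm.
    assert (H1 := is_CRInt_minus _ _ _ _ _ _
      (is_CRInt_minus _ _ _ _ _ _ (Havg F _ HFc Hzh) (Havg F _ HFc Hz))
      (is_CRInt_Cmult h _ _ _ _ (Havg f _ Hf Hz))).
    apply (Cmod_is_CRInt_le _ 0 (2 * PI) _ (eps * r * Cmod h) PI2_pos) in H1.
    2: { intros x _. simpl. rewrite Hshift.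
      match goal with |- Cmod ?y <= _ => replace y with
        (cis (-1 * x) * (F (circ z r x + h)%C - F (circ z r x) - f (circ z r x) * h))%C by ring end.
      rewrite Cmod_mult, Cmod_cis, Rmult_1_l. apply Hud; auto. }
    apply (Rmult_le_compat_l (/ (2 * PI * r))) in H1.
    2: { apply Rlt_le, Rinv_0_lt_compat, Hpr. }
    eapply Rle_trans; [ exact H1 | ]. right. field. lra.
  - apply C_continuous_eps. intros eps Heps.
    destruct (uniform_continuity_disc f c (2 * r)) with (eps := eps / 2 * r)
      as [d [Hd Huc]]; try (rewrite H22; assumption).
    { apply Rmult_lt_0_compat; lra. }
    exists (Rmin d (r - Cmod (z - c))). split; [ apply Rmin_glb_lt; lra | ].
    intros w Hw.
    assert (Hh1 := Rlt_le_trans _ _ _ Hw (Rmin_l _ _)).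
    assert (Hh2 := Rlt_le_trans _ _ _ Hw (Rmin_r _ _)).
    assert (Hwc : Cmod (w - c) < r).
    { replace (w - c)%C with ((z - c) + (w - z))%C by ring.
      eapply Rle_lt_trans; [ apply Cmod_triangle | ]. lra. }
    replace (k * avg f w - k * avg f z)%C with (k * (avg f w - avg f z))%C by ring.
    rewrite Cmod_mult, Hkm.
    assert (H1 := is_CRInt_minus _ _ _ _ _ _ (Havg f _ Hf Hwc) (Havg f _ Hf Hz)).
    apply (Cmod_is_CRInt_le _ 0 (2 * PI) _ (eps / 2 * r) PI2_pos) in H1.
    2: { intros x _. simpl.
      replace (cis (-1 * x) * f (circ w r x) - cis (-1 * x) * f (circ z r x))%C
        with (cis (-1 * x) * (f (circ w r x) - f (circ z r x)))%C by ring.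
      rewrite Cmod_mult, Cmod_cis, Rmult_1_l. apply Huc; [ auto | ].
      replace (circ w r x - circ z r x)%C with (w - z)%C by (unfold circ; ring). exact Hh1. }
    apply (Rmult_le_compat_l (/ (2 * PI * r))) in H1.
    2: { apply Rlt_le, Rinv_0_lt_compat, Hpr. }
    eapply Rle_lt_trans; [ exact H1 | ].
    replace (/ (2 * PI * r) * ((2 * PI - 0) * (eps / 2 * r))) with (eps / 2) by (field; lra).
    lra.
Qed.

Theorem holomorphic_derive (O : C -> Prop) (f g : C -> C) :
  @open C_UniformSpace O -> (forall w, O w -> is_C_derive f w (g w)) ->
  forall c, O c -> exists l, is_C_derive g c l.
Proof.
  intros HO Hf c Hc.
  assert (H := HO c Hc). apply locally_C_Cmod in H. destruct H as [R0 [HR0 HR]].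
  set (R1 := R0 / 2).
  assert (HfR : forall w, Cdisc c R1 w -> exists l, is_C_derive f w l).
  { intros w Hw. exists (g w). apply Hf, HR. unfold Cdisc, R1 in Hw. lra. }
  assert (HF := holomorphic_primitive f c R1 HfR).
  (* [C1_derive] needs four times its radius, and [HF] holds only in the open disc of radius [R1];
     dividing by 5 gives the strict inclusion, here and again for [R1 / 25]. *)
  destruct (C1_derive (seg_int f c) f c (R1 / 5)) as [l Hl].
  - unfold R1. lra.
  - intros w Hw. apply HF. unfold Cdisc, R1 in *. lra.
  - intros w Hw. apply is_C_derive_continuous with (g w). apply Hf, HR.
    unfold Cdisc, R1 in Hw. lra.
  - destruct (C1_derive f l c (R1 / 25)) as [l' Hl'].
    + unfold R1. lra.
    + intros w Hw. apply Hl. unfold Cdisc, R1 in *. lra.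
    + intros w Hw. apply Hl. unfold Cdisc, R1 in *. lra.
    (* The function [l] agrees with [g] only near [c], by uniqueness of derivatives. *)
    + exists (l' c). apply (is_derive_ext_loc (K := C_AbsRing) (V := C_NormedModule) l).
      * apply locally_C, locally_C_Cmod. exists (R1 / 5). split; [ unfold R1; lra | ].
        intros w Hw. rewrite <- (is_C_derive_unique f w (g w)).
        -- symmetry. apply is_C_derive_unique. now apply Hl.
        -- apply Hf, HR. unfold R1 in Hw. lra.
      * apply Hl'. replace (c - c)%C with (RtoC 0) by ring. rewrite Cmod_0. unfold R1. lra.
Qed.

(** * The leading Taylor term *)

Lemma Cderiv_n_correct (O : C -> Prop) (g : C -> C) (k : nat) (w : C) :
  holomorphic_on O g -> O w -> is_C_derive (Cderiv_n k g) w (Cderiv_n (S k) g w).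
Proof.
  intros [HO Hg]. revert w. induction k as [ | k IH ]; intros w Hw.
  - apply (C_derive_correct g w (RtoC 0)). auto.
  - destruct (holomorphic_derive O (Cderiv_n k g) (Cderiv_n (S k) g) HO IH w Hw) as [l Hl].
    apply (C_derive_correct (Cderiv_n (S k) g) w (RtoC 0)). now exists l.
Qed.

Lemma is_C_derive_mult (f g : C -> C) (w l m : C) :
  is_C_derive f w l -> is_C_derive g w m ->
  is_C_derive (fun v => (f v * g v)%C) w (l * g w + f w * m)%C.
Proof.
  intros [_ Hf] [_ Hg].
  assert (H : @is_derive C_AbsRing (AbsRing_NormedModule C_AbsRing)
    (fun v => (f v * g v)%C) w (l * g w + f w * m)%C).
  { apply (is_derive_mult (K := C_AbsRing) f g w l m);
    [ split; [ apply is_linear_scal_l | exact Hf ]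
    | split; [ apply is_linear_scal_l | exact Hg ]
    | exact Cmult_comm ]. }
  destruct H as [_ H]. split; [ apply is_linear_scal_l | exact H ].
Qed.

Lemma is_C_derive_Cmult (c : C) (f : C -> C) (w l : C) :
  is_C_derive f w l -> is_C_derive (fun v => (c * f v)%C) w (c * l)%C.
Proof.
  intros H. replace (c * l)%C with (RtoC 0 * f w + c * l)%C by ring.
  apply (is_C_derive_mult (fun _ => c)); [ | exact H ].
  exact (is_derive_const (K := C_AbsRing) (V := C_NormedModule) c w).
Qed.

(* [mono n z] is [z ^ n / n!]. *)
Fixpoint mono (n : nat) (z : C) : C :=
  match n with
  | O => RtoC 1
  | S m => (RtoC (/ INR (S m)) * (z * mono m z))%C
  end.

Lemma Cmod_mono (n : nat) (z : C) : Cmod (mono n z) = Cmod z ^ n / INR (fact n).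
Proof.
  induction n as [ | n IH ].
  - simpl. rewrite Cmod_1. field.
  - change (mono (S n) z) with (RtoC (/ INR (S n)) * (z * mono n z))%C.
    assert (Hn : 0 < INR (S n)) by (apply lt_0_INR; lia).
    assert (Hf := INR_fact_lt_0 n).
    rewrite !Cmod_mult, IH, Cmod_R, Rabs_right.
    2: { apply Rle_ge, Rlt_le, Rinv_0_lt_compat, Hn. }
    rewrite fact_simpl, mult_INR. simpl pow. field. lra.
Qed.

Lemma is_C_derive_mono (n : nat) (z0 w : C) :
  is_C_derive (fun v => mono (S n) (v - z0)%C) w (mono n (w - z0)%C).
Proof.
  assert (Hid : is_C_derive (fun v => (v - z0)%C) w (RtoC 1)).
  { apply is_C_derive_eps. intros e He. exists 1. split; [ lra | ]. intros h _.
    replace (w + h - z0 - (w - z0) - RtoC 1 * h)%C with (RtoC 0) by ring.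
    rewrite Cmod_0. apply Rmult_le_pos; [ lra | apply Cmod_ge_0 ]. }
  assert (H1 : is_C_derive (fun v => mono 0 (v - z0)%C) w (RtoC 0)).
  { exact (is_derive_const (K := C_AbsRing) (V := C_NormedModule) (RtoC 1) w). }
  induction n as [ | n IH ].
  - assert (H := is_C_derive_Cmult (RtoC (/ INR 1)) _ _ _ (is_C_derive_mult _ _ _ _ _ Hid H1)).
    replace (mono 0 (w - z0)) with (RtoC (/ INR 1) *
      (RtoC 1 * mono 0 (w - z0) + (w - z0) * RtoC 0))%C; [ exact H | ].
    simpl. rewrite Rinv_1. ring.
  - assert (H := is_C_derive_Cmult (RtoC (/ INR (S (S n)))) _ _ _
      (is_C_derive_mult _ _ _ _ _ Hid IH)).
    refine (eq_ind _ (is_C_derive _ w) H _ _).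
    change (mono (S n) (w - z0)) with (RtoC (/ INR (S n)) * ((w - z0) * mono n (w - z0)))%C.
    set (x := ((w - z0) * mono n (w - z0))%C).
    (* Both summands of the product rule are multiples of [x], since [mono (S n)] is [x / (n + 1)];
       the total factor is [(1 + 1 / (n + 1)) / (n + 2) = 1 / (n + 1)]. *)
    transitivity (RtoC (/ INR (S (S n)) * (1 + / INR (S n)) * INR (S n)) * (RtoC (/ INR (S n)) * x))%C.
    + replace ((w - z0) * mono n (w - z0))%C with x by reflexivity.
      replace (RtoC (/ INR (S (S n)) * (1 + / INR (S n)) * INR (S n)) * (RtoC (/ INR (S n)) * x))%C
        with (RtoC (/ INR (S (S n)) * (1 + / INR (S n)) * INR (S n) * / INR (S n)) * x)%C
        by (rewrite (RtoC_mult _ (/ INR (S n))); ring).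
      rewrite Rmult_assoc, Rinv_r, Rmult_1_r by (apply not_0_INR; lia).
      rewrite RtoC_mult, RtoC_plus. unfold x. Cring.
    + replace (/ INR (S (S n)) * (1 + / INR (S n)) * INR (S n)) with 1; [ Cring | ].
      rewrite (S_INR (S n)). assert (0 < INR (S n)) by (apply lt_0_INR; lia). field. lra.
Qed.

Lemma C_mean_value_bound (F f : C -> C) (a b : C) (M : R) :
  (forall t, 0 <= t <= 1 -> is_C_derive F (seg a b t) (f (seg a b t))) ->
  seg_continuous f a b ->
  (forall t, 0 <= t <= 1 -> Cmod (f (seg a b t)) <= M) ->
  Cmod (F b - F a) <= M * Cmod (b - a).
Proof.
  intros HF Hf HM. rewrite <- (seg_int_FTC F f a b HF Hf). now apply seg_int_bound.
Qed.

(** Induction on [n] for all sequences [d]: the estimate for the shifted sequence bounds the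
    derivative of [d O - a * mono (S n)], and the mean value bound integrates it. Each step adds one
    value at [z0], at most [eta]; [Cmod h <= 1] keeps the earlier ones from growing. *)
Lemma taylor_leading_term (z0 : C) (delta M eta : R) (n : nat) :
  forall d : nat -> C -> C,
  0 <= eta -> 0 <= M ->
  (forall k w, Cmod (w - z0) < delta -> is_C_derive (d k) w (d (S k) w)) ->
  (forall w, Cmod (w - z0) < delta -> Cmod (d (S n) w) <= M) ->
  (forall k, (k < n)%nat -> Cmod (d k z0) <= eta) ->
  forall h, Cmod h < delta -> Cmod h <= 1 ->
  Cmod (d O (z0 + h)%C - d n z0 * mono n h)%C <= M * Cmod h ^ S n + INR n * eta.
Proof.
  induction n as [ | n IH ]; intros d Heta HM Hd Hbound Hsmall h Hh Hh1.
  - assert (Hin : forall t, 0 <= t <= 1 -> Cmod (seg z0 (z0 + h) t - z0) < delta).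
    { intros t Ht. eapply Rle_lt_trans; [ now apply seg_minus_le | exact Hh ]. }
    assert (H := C_mean_value_bound (d O) (d 1%nat) z0 (z0 + h)%C M
      (fun t Ht => Hd O _ (Hin t Ht))
      (fun t Ht => is_C_derive_continuous _ _ _ (Hd 1%nat _ (Hin t Ht)))
      (fun t Ht => Hbound _ (Hin t Ht))).
    replace (z0 + h - z0)%C with h in H by ring.
    simpl. replace (d O z0 * RtoC 1)%C with (d O z0) by ring. lra.
  - assert (Hin : forall t, 0 <= t <= 1 -> Cmod (seg z0 (z0 + h) t - z0) < delta).
    { intros t Ht. eapply Rle_lt_trans; [ now apply seg_minus_le | exact Hh ]. }
    set (a := d (S n) z0).
    assert (Hshift : forall w, Cmod (w - z0) < delta -> Cmod (w - z0) <= 1 ->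
       Cmod (d 1%nat w - a * mono n (w - z0))%C <= M * Cmod (w - z0) ^ S n + INR n * eta).
    { intros w Hw Hw1.
      assert (H := IH (fun k => d (S k)) Heta HM (fun k => Hd (S k)) Hbound
        (fun k Hk => Hsmall (S k) (proj1 (Nat.succ_lt_mono k n) Hk)) (w - z0)%C Hw Hw1).
      simpl in H. now replace (z0 + (w - z0))%C with w in H by ring. }
    assert (Hder : forall t, 0 <= t <= 1 ->
      is_C_derive (fun w => (d O w - a * mono (S n) (w - z0))%C) (seg z0 (z0 + h) t)
        (d 1%nat (seg z0 (z0 + h) t) - a * mono n (seg z0 (z0 + h) t - z0))%C).
    { intros t Ht.
      apply (is_derive_minus (K := C_AbsRing) (V := C_NormedModule)); [ now apply Hd, Hin | ].
      apply is_C_derive_Cmult, is_C_derive_mono. }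
    assert (Hcont : seg_continuous (fun w => (d 1%nat w - a * mono n (w - z0))%C) z0 (z0 + h)%C).
    { intros t Ht. destruct n as [ | n ].
      - apply (continuous_minus (V := C_NormedModule)).
        + eapply is_C_derive_continuous, Hd, Hin, Ht.
        + apply continuous_const.
      - eapply is_C_derive_continuous.
        apply (is_derive_minus (K := C_AbsRing) (V := C_NormedModule)); [ now apply Hd, Hin | ].
        apply is_C_derive_Cmult, is_C_derive_mono. }
    assert (Hn := pos_INR n). assert (Hc := Cmod_ge_0 h).
    assert (H := C_mean_value_bound _ _ z0 (z0 + h)%C (M * Cmod h ^ S n + INR n * eta) Hder Hcont).
    simpl in H.
    replace (z0 + h - z0)%C with h in H by ring.
    replace (z0 - z0)%C with (RtoC 0) in H by ring.
    assert (Hmv : Cmod (d O (z0 + h)%C - a * mono (S n) h - d O z0)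
       <= (M * Cmod h ^ S n + INR n * eta) * Cmod h).
    { replace (d O (z0 + h)%C - a * mono (S n) h - d O z0)%C with
       (d O (z0 + h)%C - a * mono (S n) h - (d O z0 - a * mono (S n) (RtoC 0)))%C.
      - apply H. intros t Ht.
        assert (Hs := seg_minus_le z0 h t Ht).
        eapply Rle_trans; [ apply Hshift; [ auto | lra ] | ].
        apply Rplus_le_compat_r. change (Cmod h * Cmod h ^ n) with (Cmod h ^ S n).
        apply Rmult_le_compat_l; [ exact HM | ].
        apply pow_incr. split; [ apply Cmod_ge_0 | exact Hs ].
      - simpl. ring. }
    replace (d O (z0 + h)%C - a * mono (S n) h)%C with
      ((d O (z0 + h)%C - a * mono (S n) h - d O z0) + d O z0)%C by ring.
    eapply Rle_trans; [ apply Cmod_triangle | ].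
    assert (H0 := Hsmall O ltac:(lia)).
    assert (Hne : 0 <= INR n * eta) by now apply Rmult_le_pos.
    rewrite S_INR. change (Cmod h ^ S (S n)) with (Cmod h * Cmod h ^ S n).
    assert (INR n * eta * Cmod h <= INR n * eta) by nra.
    lra.
Qed.

(** * Generalized holomorphic functions *)

Lemma ev_and (P Q : R -> Prop) : ev P -> ev Q -> ev (fun e => P e /\ Q e).
Proof.
  intros [a [Ha HP]] [b [Hb HQ]]. exists (Rmin a b). split.
  - split; [ apply Rmin_glb_lt; lra | ]. eapply Rle_trans; [ apply Rmin_l | lra ].
  - intros e He. assert (H1 := Rmin_l a b). assert (H2 := Rmin_r a b).
    split; [ apply HP | apply HQ ]; lra.
Qed.

Lemma ev_mono (P Q : R -> Prop) :
  (forall e, 0 < e <= 1 -> P e -> Q e) -> ev P -> ev Q.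
Proof.
  intros H [a [Ha HP]]. exists a. split; [ exact Ha | ].
  intros e He. apply H; [ lra | ]. now apply HP.
Qed.

Lemma ev_true (P : R -> Prop) : (forall e, 0 < e <= 1 -> P e) -> ev P.
Proof. intros H. exists 1. split; [ lra | exact H ]. Qed.

Lemma ev_forall_lt (P : nat -> R -> Prop) (n : nat) :
  (forall k, (k < n)%nat -> ev (P k)) -> ev (fun e => forall k, (k < n)%nat -> P k e).
Proof.
  induction n as [ | n IH ]; intros H.
  - apply ev_true. intros e _ k Hk. lia.
  - assert (H1 := IH (fun k Hk => H k (Nat.lt_lt_succ_r _ _ Hk))).
    assert (H2 := H n (Nat.lt_succ_diag_r n)).
    generalize (ev_and _ _ H1 H2). apply ev_mono. intros e _ [G1 G2] k Hk.
    destruct (Nat.eq_dec k n) as [-> | Hn]; [ exact G2 | apply G1; lia ].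
Qed.

Lemma not_ev (P : R -> Prop) (d : R) :
  ~ ev P -> 0 < d -> exists e, 0 < e <= 1 /\ e <= d /\ ~ P e.
Proof.
  intros HP Hd. apply NNPP. intros Hn. apply HP. exists (Rmin d 1). split.
  - split; [ apply Rmin_glb_lt; lra | apply Rmin_r ].
  - intros e He. apply NNPP. intros HPe. apply Hn. exists e.
    assert (H1 := Rmin_l d 1). assert (H2 := Rmin_r d 1). repeat split; auto; lra.
Qed.

Lemma pow_le_antitone (x : R) (m n : nat) : 0 < x <= 1 -> (m <= n)%nat -> x ^ n <= x ^ m.
Proof.
  intros Hx Hmn. replace n with (m + (n - m))%nat by lia. rewrite pow_add.
  assert (H1 : 0 < x ^ m) by (apply pow_lt; lra).
  assert (H2 : x ^ (n - m) <= 1).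
  { rewrite <- (pow1 (n - m)). apply pow_incr. lra. }
  nra.
Qed.

(* If every bound [rho ^ - N] on every ball [rho ^ N] failed along some sequence of
   indices, gluing the bad points into [z0] would give a net equivalent to [z0] at
   which the values are not moderate. *)
Lemma GH_uniform_bound (rho : rnet) (U : cnet -> Prop) (Om : R -> C -> Prop)
  (fe : R -> C -> C) (z0 : cnet) (k : nat) :
  gauge rho -> gsubset rho U -> GH rho U Om fe -> U z0 ->
  exists N : nat, ev (fun e => forall w, Cmod (w - z0 e) < rho e ^ N ->
    Om e w /\ Cmod (Cderiv_n k (fe e) w) <= / rho e ^ N).
Proof.
  intros [Hrho _] [_ HU] [_ Hf] Hz0. apply NNPP. intros Hno.
  set (bad := fun N e w => Cmod (w - z0 e) < rho e ^ N /\
     ~ (Om e w /\ Cmod (Cderiv_n k (fe e) w) <= / rho e ^ N)).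
  assert (Hs : forall N : nat, exists s : R * C,
     (0 < fst s <= 1 /\ fst s <= / (INR N + 1)) /\ bad N (fst s) (snd s)).
  { intros N.
    destruct (not_ev (fun e => forall w, Cmod (w - z0 e) < rho e ^ N ->
       Om e w /\ Cmod (Cderiv_n k (fe e) w) <= / rho e ^ N) (/ (INR N + 1))) as (e & He & He' & Hb).
    - intros H. apply Hno. now exists N.
    - apply Rinv_0_lt_compat. assert (H := pos_INR N). lra.
    - apply not_all_ex_not in Hb. destruct Hb as [w Hb]. apply imply_to_and in Hb.
      exists (e, w). unfold bad; simpl. tauto. }
  set (s := fun N => proj1_sig (constructive_indefinite_description _ (Hs N))).
  assert (Hsp : forall N, (0 < fst (s N) <= 1 /\ fst (s N) <= / (INR N + 1)) /\
     bad N (fst (s N)) (snd (s N))).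
  { intros N. unfold s. apply proj2_sig. }
  (* Several [N] may have produced the same index [e]; one bad point among them is kept, and [z0 e]
     is taken where there is none. *)
  assert (Hpick : forall e, exists w, ((exists N, fst (s N) = e) ->
     exists N, fst (s N) = e /\ bad N e w) /\ (~ (exists N, fst (s N) = e) -> w = z0 e)).
  { intros e. destruct (classic (exists N, fst (s N) = e)) as [[N HN] | Hn].
    - exists (snd (s N)). split; [ intros _; exists N | intros H; exfalso; apply H; now exists N ].
      split; [ exact HN | ]. rewrite <- HN. apply Hsp.
    - exists (z0 e). tauto. }
  set (z := fun e => proj1_sig (constructive_indefinite_description _ (Hpick e))).
  assert (Hz : forall e, ((exists N, fst (s N) = e) ->
     exists N, fst (s N) = e /\ bad N e (z e)) /\ (~ (exists N, fst (s N) = e) -> z e = z0 e)).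
  { intros e. unfold z. apply proj2_sig. }
  (* Only finitely many positive indices come from [N < q], so below all of them every bad point has
     [N >= q]. This makes [z - z0] negligible. *)
  assert (Hlarge : forall q, ev (fun e => forall N, fst (s N) = e -> (q <= N)%nat)).
  { intros q.
    assert (H : ev (fun e => forall N, (N < q)%nat -> fst (s N) <> e)).
    { apply ev_forall_lt. intros N _. destruct (Hsp N) as [[H _] _].
      exists (fst (s N) / 2). split; [ lra | ]. intros e He. lra. }
    revert H. apply ev_mono. intros e _ H N HN.
    destruct (Nat.le_gt_cases q N) as [Hq | Hq]; [ exact Hq | ].
    exfalso. exact (H N Hq HN). }
  assert (HUz : U z).
  { apply HU with z0; [ exact Hz0 | ]. intros q.
    generalize (Hlarge q). apply ev_mono. intros e He Hl. unfold csub.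
    assert (Hr := Hrho e He).
    destruct (classic (exists N, fst (s N) = e)) as [HN | HN].
    - destruct (proj1 (Hz e) HN) as [N [HNe [Hb _]]].
      apply Rlt_le, Rlt_le_trans with (rho e ^ N); [ exact Hb | ].
      apply pow_le_antitone; auto.
    - rewrite (proj2 (Hz e) HN). replace (z0 e - z0 e)%C with (RtoC 0) by ring.
      rewrite Cmod_0. apply pow_le. lra. }
  destruct (Hf z HUz) as [HOm Hmod]. destruct (Hmod k) as [N0 HN0].
  destruct (ev_and _ _ (Hlarge N0) (ev_and _ _ HOm HN0)) as [e0 [He0 Hev]].
  (* Since [1 / (M + 1) <= e0], the index of [s M] is in the range where [z] is moderate. The bad
     point kept there may belong to another [N], but [N >= N0] still gives the contradiction. *)
  destruct (nfloor_ex (/ e0)) as [M [_ HM]].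
  { apply Rlt_le, Rinv_0_lt_compat; lra. }
  destruct (Hsp M) as [[H1 H2] _].
  assert (HsM : fst (s M) <= e0).
  { eapply Rle_trans; [ exact H2 | ]. rewrite <- (Rinv_inv e0).
    apply Rinv_le_contravar; [ apply Rinv_0_lt_compat; lra | lra ]. }
  destruct (Hev (fst (s M)) ltac:(lra)) as [G1 [G2 G3]].
  destruct (proj1 (Hz (fst (s M))) (ex_intro _ M eq_refl)) as [N [HN [_ Hb]]].
  apply Hb. split; [ exact G2 | ]. eapply Rle_trans; [ exact G3 | ].
  assert (Hr := Hrho _ H1). apply Rinv_le_contravar; [ apply pow_lt; lra | ].
  apply pow_le_antitone; auto.
Qed.

(** * Choice of exponents and the conclusion *)

Lemma least_nat (P : nat -> Prop) (n : nat) :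
  P n -> exists m, P m /\ forall k, (k < m)%nat -> ~ P k.
Proof.
  induction n as [ n IH ] using (well_founded_induction Nat.lt_wf_0). intros Hn.
  destruct (classic (exists k, (k < n)%nat /\ P k)) as [[k [Hk HP]] | Hno].
  - now apply IH with k.
  - exists n. split; [ exact Hn | ]. intros k Hk HP. apply Hno. now exists k.
Qed.

Lemma gpos_pow (rho : rnet) (P : nat) : gauge rho -> gpos rho (fun e => rho e ^ P).
Proof.
  intros [Hrho Hlim]. split.
  - exists O. apply ev_true. intros e He. assert (H := Hrho e He).
    assert (H1 := pow_lt (rho e) P (proj1 H)).
    assert (H2 := pow_le_antitone (rho e) 0 P H (Nat.le_0_l P)).
    simpl in *. rewrite Rabs_right, Rinv_1 by lra. exact H2.
  (* The strict inequality [rho ^ S P < rho ^ P] requires [rho < 1], which holds for small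
     indices. *)
  - exists (S P). generalize (Hlim 1 Rlt_0_1). apply ev_mono. intros e He Hr1.
    assert (H := Hrho e He). assert (H1 := pow_lt (rho e) P (proj1 H)). simpl. nra.
Qed.

(* [x] is the modulus of the leading Taylor term; the two error terms are at most
   [x / 4] each as soon as [4 (n + 1) n! p < 1]. *)
Lemma leading_term_dominates (n q m N : nat) (p a h v : R) :
  0 < p -> 4 * (INR n + 1) * INR (fact n) * p < 1 ->
  p ^ q < a -> p ^ m < h -> h < p ^ (S q + N) ->
  a * (h ^ n / INR (fact n)) <= v + (/ p ^ N * h ^ S n + INR n * p ^ S (q + n * m)) ->
  p ^ S (q + n * m) < v.
Proof.
  intros Hp Hsmall Ha Hm Hh Hv.
  assert (Hn := pos_INR n). assert (Hf := INR_fact_lt_0 n).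
  set (F := INR (fact n)) in *.
  assert (Hpq : 0 < p ^ q) by now apply pow_lt.
  assert (HpN : 0 < p ^ N) by now apply pow_lt.
  assert (Hpm : 0 < p ^ m) by now apply pow_lt.
  assert (Hhn : 0 < h ^ n) by (apply pow_lt; lra).
  (* [y / F] bounds the leading term from below. The [S] in the bound on [h] and the [S] in the
     exponent of the lower terms each yield one factor [p], so the errors are multiples of
     [p * y]. *)
  set (y := p ^ q * h ^ n).
  assert (Hy : 0 < y) by now apply Rmult_lt_0_compat.
  assert (H1 : y <= a * h ^ n).
  { apply Rmult_le_compat_r; lra. }
  assert (H2 : / p ^ N * h ^ S n <= p * y).
  { replace (p * y) with (/ p ^ N * (p ^ (S q + N) * h ^ n)).
    - apply Rmult_le_compat_l; [ apply Rlt_le, Rinv_0_lt_compat, HpN | ].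
      simpl. apply Rmult_le_compat_r; [ lra | ]. simpl in Hh. lra.
    - unfold y. rewrite pow_add. simpl. field. lra. }
  assert (H3 : p ^ S (q + n * m) <= p * y).
  { simpl. apply Rmult_le_compat_l; [ lra | ]. unfold y. rewrite pow_add.
    apply Rmult_le_compat_l; [ lra | ]. rewrite (Nat.mul_comm n m), pow_mult.
    apply pow_incr. lra. }
  assert (HF1 : 1 <= F).
  { unfold F. apply (le_INR 1). apply lt_O_fact. }
  assert (Hv' : y <= F * v + F * (p * y + INR n * (p * y))).
  { assert (Hmul : F * (a * (h ^ n / F)) <= F * (v + (p * y + INR n * (p * y)))).
    { apply Rmult_le_compat_l; [ lra | ]. eapply Rle_trans; [ exact Hv | ].
      assert (INR n * p ^ S (q + n * m) <= INR n * (p * y)) by now apply Rmult_le_compat_l.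
      lra. }
    replace (F * (a * (h ^ n / F))) with (a * h ^ n) in Hmul by (field; lra). lra. }
  assert (Hsy : 4 * (INR n + 1) * F * p * y < 1 * y) by now apply Rmult_lt_compat_r.
  eapply Rle_lt_trans; [ exact H3 | ].
  assert (Hpy : 0 < p * y) by now apply Rmult_lt_0_compat.
  assert (Hgoal : F * (p * y) < F * v).
  { assert (0 <= INR n * (F * (p * y))).
    { apply Rmult_le_pos; [ lra | ]. apply Rmult_le_pos; lra. }
    nra. }
  apply Rmult_lt_reg_l in Hgoal; lra.
Qed.

Theorem theorem3p5 (rho : rnet) (Hrho : gauge rho)
  (U : cnet -> Prop) (HU : sharply_open rho U)
  (z0 : cnet) (Hz0 : U z0)
  (Om : R -> C -> Prop) (fe : R -> C -> C) (Hf : GH rho U Om fe)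
  (Hf0 : negligible rho (gapp fe z0))
  (Hn : exists n : nat, (0 < n)%nat /\ ~ negligible rho (gderiv n fe z0)) :
  exists L : R -> Prop, subset0 L /\
  exists r : rnet, gpos rho r /\
    (forall z, ball_sharp rho z0 r z -> U z) /\
    (forall z, ball_sharp rho z0 r z -> glt rho (fun _ => 0) (cabs (csub z z0)) ->
       invertible_on rho L (gapp fe z)).
Proof.
  destruct Hn as [n0 [_ Hn0]].
  destruct (least_nat (fun k => ~ negligible rho (gderiv k fe z0)) n0 Hn0) as [n [Hn Hlow]].
  apply not_all_ex_not in Hn. destruct Hn as [q Hq].
  destruct HU as [Hsub HU].
  destruct (GH_uniform_bound rho U Om fe z0 (S n) Hrho Hsub Hf Hz0) as [N HN].
  destruct (HU z0 Hz0) as [r' [[_ [m' Hm']] HrU]].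
  assert (Hrho' := Hrho). destruct Hrho' as [Hrho1 Hlim].
  (* [m'] keeps the ball inside [U], [N] inside the disc of the uniform bound, and [S q + N] makes
     the Taylor remainder smaller than the leading term. *)
  set (P := (m' + (S q + N))%nat).
  exists (fun e => 0 < e <= 1 /\ rho e ^ q < Cmod (gderiv n fe z0 e)). split.
  { split; [ tauto | ]. intros d Hd.
    destruct (not_ev _ (d / 2) Hq) as (e & He & Hed & Hqe); [ lra | ].
    exists e. apply Rnot_le_lt in Hqe. repeat split; lra. }
  exists (fun e => rho e ^ P). split; [ now apply gpos_pow | ]. split.
  - intros z [Hz [m Hm]]. apply HrU. split; [ exact Hz | ]. exists m.
    generalize (ev_and _ _ Hm Hm'). apply ev_mono. intros e He [H1 H2].
    assert (H3 : rho e ^ P <= rho e ^ m') by (apply pow_le_antitone; [ auto | unfold P; lia ]).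
    lra.
  - intros z [Hz [m2 Hm2]] [m Hm].
    set (c := 4 * (INR n + 1) * INR (fact n)).
    assert (Hc : 0 < c).
    { assert (H1 := pos_INR n). assert (H2 := INR_fact_lt_0 n).
      unfold c. apply Rmult_lt_0_compat; lra. }
    (* This exponent depends on [z] through [m]; only the threshold [e0] and the exponent of
       invertibility inherit that dependence, not [L] or the radius. *)
    assert (Hev : ev (fun e => forall k, (k < n)%nat ->
       Cmod (gderiv k fe z0 e) <= rho e ^ S (q + n * m))).
    { apply ev_forall_lt. intros k Hk. apply (NNPP _ (Hlow k Hk)). }
    destruct (ev_and _ _ (ev_and _ _ HN Hev) (ev_and _ _ (Hlim (/ c) (Rinv_0_lt_compat _ Hc))
      (ev_and _ _ Hm Hm2))) as [e0 [He0 H]].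
    exists (S (q + n * m)), e0. split; [ lra | ]. intros e [HeI HeL] Hee.
    destruct (H e ltac:(lra)) as [[HNe Hlowe] [Hrc [Hme Hm2e]]]. clear H.
    assert (Hre := Hrho1 e HeI). unfold cabs, csub in Hme, Hm2e.
    set (h := (z e - z0 e)%C) in *.
    assert (Hpos2 : 0 < rho e ^ m2) by (apply pow_lt; lra).
    assert (HhP : Cmod h < rho e ^ P) by lra.
    assert (HhSq : Cmod h < rho e ^ (S q + N)).
    { eapply Rlt_le_trans; [ exact HhP | ]. apply pow_le_antitone; [ auto | unfold P; lia ]. }
    assert (HhN : Cmod h < rho e ^ N).
    { eapply Rlt_le_trans; [ exact HhP | ]. apply pow_le_antitone; [ auto | unfold P; lia ]. }
    assert (Hh1 : Cmod h <= 1).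
    { apply Rlt_le. eapply Rlt_le_trans; [ exact HhN | ].
      apply (pow_le_antitone (rho e) 0); [ auto | lia ]. }
    assert (HT := taylor_leading_term (z0 e) (rho e ^ N) (/ rho e ^ N) (rho e ^ S (q + n * m)) n
      (fun k => Cderiv_n k (fe e))).
    assert (HpN : 0 < rho e ^ N) by (apply pow_lt; lra).
    specialize (HT (pow_le (rho e) _ (Rlt_le _ _ (proj1 Hre))) (Rlt_le _ _ (Rinv_0_lt_compat _ HpN))
      (fun k w Hw => Cderiv_n_correct (Om e) (fe e) k w (proj1 Hf e HeI) (proj1 (HNe w Hw)))
      (fun w Hw => proj2 (HNe w Hw)) Hlowe h HhN Hh1).
    replace (z0 e + h)%C with (z e) in HT by (unfold h; ring).
    apply Rlt_gt, leading_term_dominates with (N := N) (a := Cmod (gderiv n fe z0 e)) (h := Cmod h);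
      try lra.
    + change (c * rho e < 1).
      apply (Rmult_lt_compat_l c) in Hrc; [ | exact Hc ]. rewrite Rinv_r in Hrc; lra.
    + rewrite <- Cmod_mono, <- Cmod_mult.
      change (gapp fe z e) with (Cderiv_n 0 (fe e) (z e)).
      change (gderiv n fe z0 e) with (Cderiv_n n (fe e) (z0 e)).
      set (x := Cderiv_n 0 (fe e) (z e)) in *.
      set (y := (Cderiv_n n (fe e) (z0 e) * mono n h)%C) in *.
      replace y with (x + - (x - y))%C by ring.
      eapply Rle_trans; [ apply Cmod_triangle | ]. rewrite Cmod_opp.
      now apply Rplus_le_compat_l.
Qed.
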